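(* Let $\boldsymbol\lambda=\{\lambda_n\}_{n=0}^{\infty}$ be a bounded sequence of positive real numbers. Then the following conditions are equivalent: (i) the operator $W_{\boldsymbol\lambda}$ is conditionally positive definite (CPD), (ii) there exist $b\in\mathbb{R}$, $c\in\mathbb{R}_+$ and a compactly supported finite Borel measure $\nu$ on $\mathbb{R}_+$ such that $\nu(\{1\})=0$ and $$\hat\lambda_n = 1 + bn + c n^2 + \int_{\mathbb{R}_+} Q_n(x)\, d\nu(x), \quad n\in\mathbb{Z}_+.$$ Moreover, the triplet $(b,c,\nu)$ appearing in (ii) is unique and $\mathrm{supp}(\nu)\subseteq \big[0,\limsup_{n\to\infty}\hat\lambda_n^{1/n}\big]$.
   Context: $\mathbb{Z}_+=\{0,1,2,\dots\}$, $\mathbb{R}_+=[0,\infty)$; all measures are positive; $\mathrm{supp}(\nu)$ is the closed support of $\nu$. The polynomials $Q_n$ are $Q_0=Q_1=0$ and $Q_n(x)=\sum_{j=0}^{n-2}(n-j-1)x^j$ for $n\geq 2$. A real sequence $\{\gamma_n\}_{n=0}^\infty$ is conditionally positive definite (CPD) if $\sum_{i,j=0}^k \gamma_{i+j}\alpha_i\bar\alpha_j\geq 0$ for every finite sequence $\alpha_0,\dots,\alpha_k\in\mathbb{C}$ with $\sum_{j=0}^k\alpha_j=0$. A bounded linear operator $T$ on a complex Hilbert space $\mathcal{H}$ is CPD if the sequence $\{\|T^nh\|^2\}_{n=0}^\infty$ is CPD for every $h\in\mathcal{H}$. For a bounded sequence $\boldsymbol\lambda=\{\lambda_n\}_{n=0}^\infty$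 of positive reals, $W_{\boldsymbol\lambda}$ is the bounded operator on $\ell^2$ with $W_{\boldsymbol\lambda}e_n=\lambda_ne_{n+1}$, $n\in\mathbb{Z}_+$, where $\{e_n\}_{n=0}^\infty$ is the standard orthonormal basis of $\ell^2$ (the unilateral weighted shift with weights $\boldsymbol\lambda$). The associated sequence is $\hat\lambda_0=1$, $\hat\lambda_n=\lambda_0^2\cdots\lambda_{n-1}^2$ for $n\geq1$. *)

(* Defs.v *)
From HB Require Import structures.
From mathcomp Require Import all_boot all_order all_algebra.
From mathcomp Require Import all_classical all_reals all_analysis.
From mathcomp Require Import complex.

Set Implicit Arguments.
Unset Strict Implicit.
Unset Printing Implicit Defensive.

Import Order.TTheory GRing.Theory Num.Theory.
Import numFieldNormedType.Exports.
Import ComplexField.Normc.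

Local Open Scope classical_set_scope.
Local Open Scope ring_scope.
Local Open Scope complex_scope.

Section cpd.
Variable R : realType.

(* [0 <= z] in [R[i]] means that [z] is real and nonnegative. *)
Definition cpd_seq (gam : nat -> R) : Prop :=
  forall (k : nat) (al : 'I_k.+1 -> R[i]),
    \sum_(j < k.+1) al j = 0 ->
    0 <= \sum_(i < k.+1) \sum_(j < k.+1) (gam (i + j)%N)%:C * al i * (al j)^*.

(* Only the norm of the Hilbert space enters the definition, so it makes sense
   for linear operators on any complex normed space.  The norm of a
   [normedModType R[i]] is valued in [R[i]]; [complex.Re] brings it to [R]. *)
Definition cpd_operator (H : normedModType R[i]) (T : {linear H -> H}) : Prop :=
  forall h : H, cpd_seq (fun n => complex.Re (`|iter n T h| ^+ 2)).

End cpd.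

Section square_summable.
Variable R : realType.
Implicit Types (f g : nat -> R) (x y : nat -> R[i]^o).

Let ssum f : \bar R := (\sum_(k <oo) (f k ^+ 2)%:E)%E.

Let ssum_ge0 f : (0 <= ssum f)%E.
Proof. by apply: nneseries_ge0 => k _ _; rewrite lee_fin sqr_ge0. Qed.

Let Lnorm2E f : ('N[counting]_2%:E [EFin \o f] = sqrte (ssum f))%E.
Proof.
rewrite Lnorm_counting// -poweR12_sqrt//; congr (_ `^ _)%E.
apply: eq_eseriesr => k _.
by rewrite /= powR_mulrn// real_normK// num_real.
Qed.

Let ssumD f g : (forall k, 0 <= f k) -> (forall k, 0 <= g k) ->
  (sqrte (ssum (f \+ g)%R) <= sqrte (ssum f) + sqrte (ssum g))%E.
Proof.
by move=> f0 g0; rewrite -!Lnorm2E eminkowski// lee_fin ler1n.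
Qed.

Let le_ssum f g : (forall k, 0 <= f k <= g k) -> (ssum f <= ssum g)%E.
Proof.
move=> fg; apply: lee_nneseries => k _; rewrite lee_fin ?sqr_ge0//.
by move: (fg k) => /andP[f0 ?]; rewrite lerXn2r// ?nnegrE// (le_trans f0).
Qed.

Definition sqsum x : \bar R := (\sum_(k <oo) (normc (x k) ^+ 2)%:E)%E.

Lemma normc_ge0 (z : R[i]) : 0 <= normc z.
Proof. by case: z => a b /=; rewrite sqrtr_ge0. Qed.

Lemma sqsum_ge0 x : (0 <= sqsum x)%E.
Proof. exact: ssum_ge0. Qed.

Lemma sqsumD x y : (sqrte (sqsum (x + y)%R) <= sqrte (sqsum x) + sqrte (sqsum y))%E.
Proof.
apply: le_trans (ssumD _ _); try by move=> k; exact: normc_ge0.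
rewrite lee_sqrt; last exact: ssum_ge0.
by apply: le_ssum => k; rewrite normc_ge0/= le_normcD.
Qed.

Lemma sqsumZ (a : R[i]) x : sqsum (a *: x) = ((normc a ^+ 2)%:E * sqsum x)%E.
Proof.
rewrite /sqsum -nneseriesZl; last by move=> k _; rewrite lee_fin sqr_ge0.
by apply: eq_eseriesr => k _; rewrite -EFinM -exprMn -normcM.
Qed.

Definition ell2_pred : {pred nat -> R[i]^o} := fun x => (sqsum x < +oo)%E.

Lemma ell2_submod_closed : submod_closed ell2_pred.
Proof.
have sqrtey (u : \bar R) : (0 <= u)%E -> (sqrte u < +oo)%E = (u < +oo)%E.
  by case: u => [r _| |]//=; rewrite !ltry.
split=> [|a x y].
  by rewrite unfold_in /sqsum eseries0// => k _ _; rewrite normc0 expr0n.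
rewrite !unfold_in => xoo yoo; rewrite -sqrtey ?sqsum_ge0//.
apply: (le_lt_trans (sqsumD _ _)).
rewrite lte_add_pinfty ?sqrtey ?sqsum_ge0// sqsumZ.
by rewrite lte_mul_pinfty// ?lee_fin ?sqr_ge0//.
Qed.

HB.instance Definition _ :=
  GRing.isSubmodClosed.Build _ _ ell2_pred ell2_submod_closed.

End square_summable.

Section ell2.
Variable R : realType.

(* [R[i]^o] and not [R[i]], because the library gives [R[i]] the structure of a
   module over [R], whereas here the scalars are complex. *)
Record ell2 := Ell2 {
  ell2_val :> nat -> R[i]^o ; _ : ell2_val \in @ell2_pred R }.

HB.instance Definition _ := [isSub for ell2_val].
HB.instance Definition _ := [Choice of ell2 by <:].
HB.instance Definition _ := [SubChoice_isSubLmodule of ell2 by <:].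

Implicit Types x y : ell2.

Definition ell2_norm x : R := Num.sqrt (fine (sqsum x)).

Lemma sqsum_fin_num x : sqsum x \is a fin_num.
Proof. by rewrite ge0_fin_numE ?sqsum_ge0//; have := valP x; rewrite unfold_in. Qed.

Lemma ell2_normE x : (ell2_norm x)%:E = sqrte (sqsum x).
Proof. by rewrite -[in RHS](fineK (sqsum_fin_num x)). Qed.

Lemma ler_ell2_normD x y :
  (ell2_norm (x + y))%:C <= (ell2_norm x)%:C + (ell2_norm y)%:C.
Proof. by rewrite -rmorphD/= lecR -lee_fin EFinD !ell2_normE sqsumD. Qed.

Lemma ell2_normZ (a : R[i]) x :
  (ell2_norm (a *: x))%:C = `|a| * (ell2_norm x)%:C.
Proof.
rewrite [`|a|](_ : _ = (normc a)%:C)// -rmorphM/=; congr _%:C.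
rewrite /ell2_norm sqsumZ fineM ?sqsum_fin_num//=.
by rewrite sqrtrM ?sqr_ge0// sqrtr_sqr ger0_norm// normc_ge0.
Qed.

Lemma ell2_norm0_eq0 x : (ell2_norm x)%:C = 0 -> x = 0.
Proof.
move=> /complexI/eqP; rewrite sqrtr_eq0 => x0.
have {}x0 : (sqsum x <= 0)%E by rewrite -(fineK (sqsum_fin_num x)) lee_fin.
apply/val_inj/funext => k /=.
apply: eq0_normc; apply/eqP; rewrite -sqrf_eq0 -eqe.
have sq0 (n : nat) : (0 <= n)%N -> true -> (0 <= (normc (x n) ^+ 2)%:E)%E.
  by rewrite lee_fin sqr_ge0.
rewrite eq_le sq0// andbT; apply: le_trans x0; apply: le_trans (nneseries_lim_ge k.+1 sq0).
by rewrite big_nat_recr//= leeDr// sume_ge0// => n _; exact: sq0.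
Qed.

HB.instance Definition _ := Lmodule_isNormed.Build R[i] ell2
  ler_ell2_normD ell2_normZ ell2_norm0_eq0.

Lemma ell2_normrE x : `|x| = (ell2_norm x)%:C.
Proof. by []. Qed.

Lemma ell2_basis_subproof (n : nat) :
  (fun k => (k == n)%:R) \in @ell2_pred R.
Proof.
rewrite unfold_in /sqsum (nneseries_split 0 n.+1); last first.
  by move=> k _; rewrite lee_fin sqr_ge0.
rewrite add0n eseries0 ?adde0.
  by rewrite sumEFin ltry.
by move=> k nk _; rewrite gtn_eqF// mulr0n normc0 expr0n.
Qed.

Definition ell2_basis (n : nat) : ell2 := Ell2 (ell2_basis_subproof n).

End ell2.

Section weighted_shift.
Variable R : realType.
Implicit Types lam : nat -> R.

Definition wshift_seq lam (x : nat -> R[i]^o) : nat -> R[i]^o :=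
  fun n => if n is m.+1 then (lam m)%:C * x m else 0.

Lemma sqsum_wshift lam (x : nat -> R[i]^o) (M : R) :
  (forall n, `|lam n| <= M) ->
  (sqsum (wshift_seq lam x) <= (M ^+ 2)%:E * sqsum x)%E.
Proof.
move=> lamM; have ge0 (y : nat -> R[i]^o) (k : nat) (_ : true) :
  (0 <= (normc (y k) ^+ 2)%:E)%E by rewrite lee_fin sqr_ge0.
rewrite /sqsum nneseries_recl//; last by move=> k _; exact: ge0.
rewrite [wshift_seq _ _ 0%N]/(0 : R[i]) normc0 expr0n add0e -(nneseries_addn 1); last first.
  by move=> k; exact: ge0.
rewrite -nneseriesZl; last by move=> k; exact: ge0.
apply: lee_nneseries => k _; first by move=> _; exact: ge0.
rewrite addn1/= normcM exprMn -EFinM lee_fin ler_wpM2r ?sqr_ge0//.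
rewrite lerXn2r ?nnegrE ?normc_ge0 ?(le_trans _ (lamM k))//.
by rewrite /= expr0n addr0 sqrtr_sqr.
Qed.

Lemma wshift_subproof lam (lam_bd : bounded_fun lam) (x : ell2 R) :
  wshift_seq lam x \in @ell2_pred R.
Proof.
have [M [_ /(_ (M + 1))]] := lam_bd; rewrite ltrDl => /(_ ltr01) lamM.
rewrite unfold_in (le_lt_trans (sqsum_wshift _ (fun n => lamM n I)))//.
by rewrite lte_mul_pinfty// ?lee_fin ?sqr_ge0//; exact: valP x.
Qed.

Definition wshift lam (lam_bd : bounded_fun lam) (x : ell2 R) :
  ell2 R := Ell2 (wshift_subproof lam_bd x).

Lemma wshift_linear lam (lam_bd : bounded_fun lam) :
  linear (wshift lam_bd).
Proof.
move=> a x y; apply/val_inj/funext => -[|n] /=.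
  by rewrite [RHS](_ : _ = a * 0 + 0)// mulr0 addr0.
rewrite [RHS](_ : _ = a * ((lam n)%:C * x n) + (lam n)%:C * y n)//.
by rewrite [X in _ * X](_ : _ = a * x n + y n)// mulrDr mulrCA.
Qed.

HB.instance Definition _ lam (lam_bd : bounded_fun lam) :=
  GRing.isLinear.Build R[i] (ell2 R) (ell2 R) _ (wshift lam_bd)
    (wshift_linear lam_bd).

Lemma wshift_basis lam (lam_bd : bounded_fun lam) (n : nat) :
  wshift lam_bd (ell2_basis R n) = (lam n)%:C *: ell2_basis R n.+1.
Proof.
apply/val_inj/funext => -[|k] /=.
  by rewrite [RHS](_ : _ = (lam n)%:C * 0)// mulr0.
rewrite [RHS](_ : _ = (lam n)%:C * (k == n)%:R)//.
by case: eqVneq => [->//|_]; rewrite !mulr0.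
Qed.

Lemma ler_norm_wshift lam (lam_bd : bounded_fun lam) (M : R) (x : ell2 R) :
  (forall n, `|lam n| <= M) -> `|wshift lam_bd x| <= M%:C * `|x|.
Proof.
move=> lamM; have M0 : 0 <= M by exact: le_trans (lamM 0%N).
rewrite !ell2_normrE -rmorphM lecR /ell2_norm -[in leRHS](ger0_norm M0).
rewrite -sqrtr_sqr -sqrtrM ?sqr_ge0// ler_wsqrtr// -lee_fin EFinM.
by rewrite !fineK ?sqsum_fin_num//; exact: sqsum_wshift.
Qed.

Lemma wshift_continuous lam (lam_bd : bounded_fun lam) :
  continuous (wshift lam_bd).
Proof.
have [M [_ /(_ (M + 1))]] := lam_bd; rewrite ltrDl => /(_ ltr01) lamM.
apply: bounded_linear_continuous; apply/linear_boundedP.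
exists (`|M + 1|)%:C; split; first by rewrite ger0_real// (_ : 0 = 0%:C)// lecR.
move=> r Mr x; apply: (le_trans (ler_norm_wshift lam_bd x (fun n => lamM n I))).
rewrite ler_wpM2r// (le_trans _ (ltW Mr))// lecR ler_norm//.
Qed.

Definition hat_seq lam (n : nat) : R := \prod_(i < n) lam i ^+ 2.

End weighted_shift.

Section representation.
Variable R : realType.

(* The bound [n.-1] gives [Q_0 = Q_1 = 0], and the natural number subtractions
   are never truncated since [j < n.-1]. *)
Definition Qpoly (n : nat) : {poly R} := \poly_(j < n.-1) (n - j - 1)%:R.

Definition msupp (nu : set R -> \bar R) : set R :=
  [set x | forall U : set R, open U -> U x -> (0 < nu U)%E].

(* A Borel measure on [0, +oo[ is a Borel measure on the line for which the
   negative half-line is null. *)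
Definition cpd_triplet (lam : nat -> R) (b c : R)
    (nu : {finite_measure set (measurableTypeR R) -> \bar R}) : Prop :=
  [/\ 0 <= c,
      nu `]-oo, 0[%classic = 0%E /\ compact (msupp nu),
      nu [set (1 : R)] = 0%E
    & forall n : nat, (hat_seq lam n)%:E =
        ((1 + b * n%:R + c * n%:R ^+ 2)%:E
         + \int[nu]_(x in `[0%R, +oo[) ((Qpoly n).[x])%:E)%E].

End representation.

(* Main.v *)
From HB Require Import structures.
Require Import Defs.
From mathcomp Require Import all_boot all_order all_algebra.
From mathcomp Require Import all_classical all_reals all_analysis.
From mathcomp Require Import measurable_realfun.
From mathcomp Require Import complex ring lra zify.

(** Write g for the sequence of the squared weight products.  The squared norms of
    W^n h are combinations of the shifted sequences g (m + n) with nonnegative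
    coefficients (cpd_operator_wshift), so W is conditionally positive definite if
    and only if all the shifts of g are.  For a real sequence, this property says
    that the linear functional L with L(x^n) = g n is nonnegative on the squares of
    the real polynomials vanishing at 1.  These polynomials are the multiples of
    x - 1, and (x - 1)^2 acts as the second difference: the condition becomes that
    the second differences of g form a positive definite sequence
    (cpd_seq_diff2P).  For g and its first shift together, it says that the second
    differences of g satisfy the two positivity conditions of the Stieltjes moment
    problem.

    Since the weights are bounded, the second differences grow at most
    exponentially, and the moment problem has a solution on a compact interval
    (stieltjes_moment).  After rescaling to [0, 1], log-convexity shows that L is
    also nonnegative on (1 - x) q^2 (momf_le1), hence on all the Bernstein
    polynomials x^j (1 - x)^k.  The values of L on these are the masses of discrete
    measures on the points k / n, whose moments converge to those of L
    (cvg_bweight_moment).  Their quantile functions are nondecreasing with values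
    in [0, 1]; they have a pointwise limit along an ultrafilter, and the image of
    Lebesgue measure under this limit solves the moment problem
    (hausdorff_moment).

    The mass at 1 of the representing measure is 2 c and the rest of it is nu.  The
    second difference in n of Q_n(x) is x^n, that of c n^2 is 2 c, and an affine
    function of n is what second differences lose: this gives the formula for g.
    Conversely, a representing triplet expresses the second differences of g as the
    moments of nu plus a mass 2 c at 1, a measure on [0, +oo[, which yields the
    positivity of all shifts.  It also yields uniqueness, because the moments of a
    measure on a compact interval determine it (supported_moments_unique).
    Finally, the moments of nu are bounded by g (n + 2) + g n, so they cannot grow
    faster than the n-th powers of any number beyond the upper limit of the n-th
    roots of g n (cpd_triplet_msupp). *)

Set Implicit Arguments.
Unset Strict Implicit.
Unset Printing Implicit Defensive.

Import Order.TTheory GRing.Theory Num.Theory.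
Import numFieldNormedType.Exports.
Import ComplexField.Normc.

Local Open Scope classical_set_scope.
Local Open Scope ring_scope.

(** * The moment functional of a sequence *)

Section moment_functional.
Variable R : comNzRingType.
Implicit Types (s : nat -> R) (p q : {poly R}).

(** The linear functional L with L(x^n) = s n.  Working with L instead of Hankel
    matrices turns quadratic-form conditions into algebra of polynomials. *)
Definition momf s p : R := \sum_(i < size p) p`_i * s i.

Lemma momfE s p n : (size p <= n)%N -> momf s p = \sum_(i < n) p`_i * s i.
Proof.
move=> pn; rewrite /momf (big_ord_widen_cond _ xpredT (fun i => p`_i * s i) pn).
rewrite [RHS](bigID (fun i : 'I_n => (i < size p)%N))/= [X in _ + X]big1 ?addr0//.
by move=> i; rewrite -leqNgt => /(nth_default _) ->; rewrite mul0r.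
Qed.

Fact momf_is_scalar s : scalar (momf s).
Proof.
move=> a p q; pose n := maxn (size p) (size q).
rewrite !(@momfE _ _ n) ?leq_maxl ?leq_maxr//; last first.
  rewrite (leq_trans (size_polyD _ _))// geq_max (leq_trans (size_scale_leq _ _)).
    by rewrite leq_maxr.
  by rewrite leq_maxl.
rewrite mulr_sumr -big_split/=; apply: eq_bigr => i _.
by rewrite coefD coefZ mulrDl mulrA.
Qed.

HB.instance Definition _ s :=
  GRing.isLinear.Build R {poly R} R _ (momf s) (momf_is_scalar s).

Lemma momfXn s n : momf s 'X^n = s n.
Proof.
rewrite /momf size_polyXn big_ord_recr/= coefXn eqxx mul1r big1 ?add0r//.
by move=> i _; rewrite coefXn ltn_eqF// mul0r.
Qed.

Lemma momf1 s : momf s 1 = s 0%N. Proof. by rewrite -[RHS]momfXn expr0. Qed.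

Lemma eq_on_Xn (f g : {scalar {poly R}}) : (forall n, f 'X^n = g 'X^n) -> f =1 g.
Proof.
move=> fg p; rewrite -[p]coefK poly_def !linear_sum/=; apply: eq_bigr => i _.
by rewrite !linearZ/= fg.
Qed.

Lemma eq_momf s t : s =1 t -> momf s =1 momf t.
Proof. by move=> st p; apply: eq_bigr => i _; rewrite st. Qed.

Lemma momf_mulXn s m p : momf s ('X^m * p) = momf (fun n => s (m + n)%N) p.
Proof.
rewrite -[p]coefK poly_def mulr_sumr !linear_sum/=; apply: eq_bigr => i _.
by rewrite -scalerAr -exprD !linearZ/= !momfXn.
Qed.

Lemma momfM s p q n : (size p <= n)%N -> (size q <= n)%N ->
  momf s (p * q) = \sum_(i < n) \sum_(j < n) s (i + j)%N * p`_i * q`_j.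
Proof.
move=> pn qn.
have widen (r : {poly R}) : (size r <= n)%N -> r = \sum_(i < n) r`_i *: 'X^i.
  by move=> rn; rewrite -poly_def; apply/polyP => i; rewrite coef_poly;
     case: ltnP => // ni; rewrite nth_default// (leq_trans rn).
rewrite {1}(widen p pn) mulr_suml linear_sum/=; apply: eq_bigr => i _.
rewrite {1}(widen q qn) mulr_sumr linear_sum/=; apply: eq_bigr => j _.
rewrite -scalerAl -scalerAr -exprD !linearZ/= momfXn; ring.
Qed.

Definition diff2 s n := s n.+2 - 2 * s n.+1 + s n.

(** The second difference of the sequence of values of x^n is (x - 1)^2 x^n. *)
Lemma momf_diff2 s p : momf (diff2 s) p = momf s (('X - 1) ^+ 2 * p).
Proof.
rewrite -[p]coefK poly_def mulr_sumr !linear_sum/=; apply: eq_bigr => i _.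
rewrite -scalerAr !linearZ/= momfXn; congr (_ * _).
rewrite (_ : _ * _ = 'X^(i.+2) - 2%:R *: 'X^(i.+1) + 'X^i); last first.
  by rewrite !exprS scaler_nat; ring.
by rewrite linearD linearB linearZ/= !momfXn /diff2.
Qed.

End moment_functional.

(** * Bernoulli's inequality *)

Section bernoulli.
Variable R : realType.

Lemma bernoulli_le (x : R) n : -1 <= x -> 1 + n%:R * x <= (1 + x) ^+ n.
Proof.
move=> x1; elim: n => [|n IH]; first by rewrite mul0r addr0.
rewrite exprS; apply: le_trans (ler_wpM2l _ IH); last by rewrite -lerBlDl sub0r.
rewrite -natr1; have : 0 <= n%:R * x ^+ 2 by rewrite mulr_ge0 ?sqr_ge0.
rewrite expr2; nra.
Qed.

Lemma exprn_unbounded (r : R) : 1 < r -> forall y, exists n, y < r ^+ n.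
Proof.
move=> r1 y; have d0 : 0 < r - 1 by rewrite subr_gt0.
exists (Num.truncn (`|y| / (r - 1))).+1.
rewrite -[X in X ^+ _](subrK 1) addrC.
apply: lt_le_trans (bernoulli_le _ _); last by lra.
rewrite ltr_wpDl// (le_lt_trans (ler_norm _))// -ltr_pdivrMr//.
by rewrite truncnS_gt.
Qed.

Lemma powR_inv_lt (a r : R) n : 0 < a -> (0 < n)%N -> a `^ n%:R^-1 < r -> a < r ^+ n.
Proof.
move=> a0 n0 ar; have r0 : 0 <= r by apply: le_trans (ltW ar); exact: powR_ge0.
have <- : (a `^ n%:R^-1) ^+ n = a.
  by rewrite -powR_mulrn ?powR_ge0// -powRrM mulVf ?pnatr_eq0 -?lt0n// powRr1// ltW.
by rewrite ltr_pXn2r// ?nnegrE// powR_ge0.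
Qed.

End bernoulli.

(** * Positivity conditions on the moment functional *)

Section cpd_real.
Variable R : realType.
Implicit Types (g s : nat -> R) (p q : {poly R}).

(** The kernel g (i + j) is real and symmetric, so its Hermitian form at a + i b
    is the sum of its values at a and at b, and real vectors suffice. *)
Lemma cpd_seqP g : cpd_seq g <-> (forall p, p.[1] = 0 -> 0 <= momf g (p * p)).
Proof.
(* The form splits because its cross terms g (i + j) (b_i a_j - a_i b_j) sum to
   zero. *)
have key k (al : 'I_k.+1 -> R[i]) (a := \poly_(i < k.+1) complex.Re (al (inord i)))
    (b := \poly_(i < k.+1) complex.Im (al (inord i))) :
    \sum_(i < k.+1) \sum_(j < k.+1) ((g (i + j)%N)%:C * al i * (al j)^*)%C =
    (momf g (a * a) + momf g (b * b))%:C%C.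
  have coefa (i : 'I_k.+1) : a`_i = complex.Re (al i).
    by rewrite coef_poly ltn_ord inord_val.
  have coefb (i : 'I_k.+1) : b`_i = complex.Im (al i).
    by rewrite coef_poly ltn_ord inord_val.
  rewrite !(@momfM _ _ _ _ k.+1) ?size_poly//.
  apply/eqP; rewrite eq_complex; apply/andP; split; apply/eqP => /=.
    rewrite raddf_sum/= -big_split/=; apply: eq_bigr => i _.
    rewrite raddf_sum/= -big_split/=; apply: eq_bigr => j _.
    by rewrite !coefa !coefb; case: (al i) => x y; case: (al j) => z t /=; ring.
  rewrite raddf_sum/=; under eq_bigr do rewrite raddf_sum/=.
  transitivity (momf g (b * a) - momf g (a * b)); last by rewrite mulrC subrr.
  rewrite !(@momfM _ _ _ _ k.+1) ?size_poly// -sumrB; apply: eq_bigr => i _.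
  rewrite -sumrB; apply: eq_bigr => j _.
  by rewrite !coefa !coefb; case: (al i) => x y; case: (al j) => z t /=; ring.
split=> [gcpd p p1|gpos k al al0].
  have /= := gcpd (size p) (fun i => (p`_i)%:C%C).
  rewrite key /= lecR.
  have -> : \poly_(i < (size p).+1) (p`_(inord i : 'I_(size p).+1)) = p.
    apply/polyP => i; rewrite coef_poly; case: ltnP => ip; first by rewrite inordK.
    by rewrite nth_default// ltnW.
  have -> : \poly_(i < (size p).+1) (0 : R) = 0.
    by apply/polyP => i; rewrite coef_poly coef0; case: ifP.
  rewrite mulr0 raddf0 addr0.
  apply; apply/eqP; rewrite eq_complex raddf_sum/= raddf_sum/= sumr_const mul0rn eqxx andbT.
  rewrite -[X in _ == X]p1 horner_coef big_ord_recr/= nth_default// addr0.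
  by apply/eqP/eq_bigr => i _; rewrite expr1n mulr1.
rewrite key lecR addr_ge0// gpos// horner_poly.
  transitivity (complex.Re (\sum_(j < k.+1) al j)); last by rewrite al0.
  by rewrite raddf_sum/=; apply: eq_bigr => i _; rewrite expr1n mulr1 inord_val.
transitivity (complex.Im (\sum_(j < k.+1) al j)); last by rewrite al0.
by rewrite raddf_sum/=; apply: eq_bigr => i _; rewrite expr1n mulr1 inord_val.
Qed.

(** The polynomials vanishing at 1 are the multiples of x - 1, and multiplying
    by (x - 1)^2 amounts to taking second differences. *)
Lemma cpd_seq_diff2P g :
  cpd_seq g <-> (forall q, 0 <= momf (diff2 g) (q * q)).
Proof.
rewrite cpd_seqP; split=> [gpos q|dpos p].
  rewrite momf_diff2 (_ : _ * _ = (('X - 1) * q) * (('X - 1) * q)); last by ring.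
  by apply: gpos; rewrite hornerM -polyC1 hornerXsubC subrr mul0r.
move=> /eqP; rewrite -/(root p 1) => /factor_theorem[q ->].
have := dpos q; rewrite momf_diff2 polyC1; congr (_ <= momf _ _); ring.
Qed.

(** The numbers a_k = L(x^k q^2) form a nonnegative log-convex sequence, because L
    is nonnegative on x^k times a square.  If a_1 > a_0, then the ratios of
    consecutive terms would be at least a_1 / a_0 > 1 and a_k would be unbounded,
    against the boundedness of s. *)
Lemma momf_le1 s (C : R) : (forall n, `|s n| <= C) ->
  (forall q, 0 <= momf s (q * q)) -> (forall q, 0 <= momf s ('X * (q * q))) ->
  forall q, 0 <= momf s ((1 - 'X) * (q * q)).
Proof.
move=> sC s0 s1 q; pose a k := momf s ('X^k * (q * q)).
have age0 k q' : 0 <= momf s ('X^k * (q' * q')).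
  rewrite -[k]odd_double_half exprD -mul2n mulnC exprM.
  case: (odd k); rewrite ?(expr0,expr1,mul1r).
    by have := s1 ('X^(k./2) * q'); congr (_ <= momf _ _); ring.
  by have := s0 ('X^(k./2) * q'); congr (_ <= momf _ _); ring.
(* The left-hand side is L(x^k ((t - x) q)^2), a quadratic polynomial in t whose
   discriminant gives log-convexity. *)
have aconv k t : 0 <= t ^+ 2 * a k - 2 * t * a k.+1 + a k.+2.
  have := age0 k ((t%:P - 'X) * q).
  rewrite (_ : _ * _ = (t ^+ 2) *: ('X^k * (q * q) : {poly R})
     - (2 * t) *: ('X^(k.+1) * (q * q) : {poly R}) + 'X^(k.+2) * (q * q)).
    by rewrite linearD linearB !linearZ.
  rewrite -!mul_polyC !exprS !polyCM/=; ring.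
have aS k : a k.+1 ^+ 2 <= a k * a k.+2.
  have [a0|a0] := eqVneq (a k) 0; last first.
    have ak : 0 < a k by rewrite lt_neqAle eq_sym a0 age0.
    have := aconv k (a k.+1 / a k).
    rewrite [X in 0 <= X](_ : _ = (a k * a k.+2 - a k.+1 ^+ 2) / a k); last by field.
    by rewrite pmulr_lge0 ?invr_gt0// subr_ge0.
  rewrite a0 mul0r; have := age0 k.+1 q; rewrite -/(a _) le_eqVlt => /orP[/eqP <-|ak].
    by rewrite expr0n.
  (* When a_k = 0 the quadratic polynomial is affine with slope - 2 a_(k+1); at
     this t it would be negative if a_(k+1) were positive. *)
  have := aconv k ((a k.+2 + 1) / a k.+1).
  rewrite a0 mulr0 add0r -mulrA divfK ?gt_eqF//; have := age0 k.+2 q.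
  rewrite -/(a _); lra.
suff : a 1%N <= a 0%N.
  by rewrite -subr_ge0 /a -linearB/= expr1 expr0 mulrBl.
rewrite leNgt; apply/negP => a01.
have a0 : 0 < a 0%N.
  rewrite lt_neqAle age0 andbT eq_sym; apply/eqP => a0.
  have := aS 0%N; rewrite a0 mul0r leNgt exprn_gt0//; exact: le_lt_trans (age0 _ _) a01.
pose r := a 1%N / a 0%N.
have r1 : 1 < r by rewrite ltr_pdivlMr// mul1r.
have r0 : 0 < r by exact: lt_trans r1.
have aSr k : 0 < a k /\ r * a k <= a k.+1.
  elim: k => [|k [ak IH]]; first by rewrite /r divfK ?gt_eqF.
  have ak1 : 0 < a k.+1 by apply: lt_le_trans IH; rewrite mulr_gt0.
  split=> //; rewrite -(ler_pM2l ak); apply: le_trans (aS k).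
  by rewrite mulrCA mulrA expr2 ler_pM2r.
have ar k : a 0%N * r ^+ k <= a k.
  elim: k => [|k IH]; first by rewrite mulr1.
  have [_] := aSr k; apply: le_trans; rewrite exprS mulrCA ler_pM2l//.
pose D := \sum_(i < size (q * q)) `|(q * q)`_i| * C.
have aD k : a k <= D.
  rewrite /a momf_mulXn /momf; apply: ler_sum => i _.
  by rewrite (le_trans (ler_norm _))// normrM ler_wpM2l.
have /(_ (D / a 0%N))[k] := exprn_unbounded r1.
rewrite ltNge ler_pdivlMr// mulrC => /negP; apply; exact: le_trans (aD k).
Qed.

End cpd_real.

(** * Bernstein weights *)

Section bernstein_weights.
Variable R : realType.
Implicit Types (s : nat -> R) (p q : {poly R}).

(** Up to a square, x^j (1 - x)^k is 1, x, 1 - x or x (1 - x), according to the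
    parities of j and k, and x (1 - x) = (1 - x) x^2 + x (1 - x)^2. *)
Lemma momf_bernstein_ge0 s (C : R) : (forall n, `|s n| <= C) ->
  (forall q, 0 <= momf s (q * q)) -> (forall q, 0 <= momf s ('X * (q * q))) ->
  forall j k, 0 <= momf s ('X^j * (1 - 'X) ^+ k).
Proof.
move=> sC s0 s1 j k; have sub1 := momf_le1 sC s0 s1.
rewrite -[j]odd_double_half -[k]odd_double_half !exprD -!mul2n !(mulnC 2) !exprM.
set x := 'X^(j./2); set y := (1 - 'X) ^+ k./2; pose q := x * y.
case: (odd j); case: (odd k); rewrite /= ?expr0 ?expr1 ?mul1r.
- rewrite [X in momf s X](_ : _ = (1 - 'X) * (('X * q) * ('X * q))
    + 'X * (((1 - 'X) * q) * ((1 - 'X) * q))); last by rewrite /q; ring.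
  by rewrite linearD/= addr_ge0.
- by have := s1 q; congr (_ <= momf _ _); rewrite /q; ring.
- by have := sub1 q; congr (_ <= momf _ _); rewrite /q; ring.
- by have := s0 q; congr (_ <= momf _ _); rewrite /q; ring.
Qed.

(** Factorial moments of the binomial weights, from k 'C(n, k) = n 'C(n - 1, k - 1). *)
Lemma sum_binomial_ffact (S : comNzRingType) (x y : S) n m :
  \sum_(k < n.+1) ('C(n, k) * k ^_ m)%:R * (x ^+ k * y ^+ (n - k)) =
  (n ^_ m)%:R * (x ^+ m * (x + y) ^+ (n - m)).
Proof.
elim: m n => [|m IH] n.
  rewrite subn0 mul1r mul1r addrC exprDn; apply: eq_bigr => k _.
  by rewrite muln1 mulr_natl mulrC.
case: n => [|n]; first by rewrite big_ord1 ffact0n muln0 !mul0r.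
rewrite big_ord_recl ffact0n muln0 mul0r add0r subSS.
transitivity (n.+1%:R * x * \sum_(k < n.+1) ('C(n, k) * k ^_ m)%:R *
    (x ^+ k * y ^+ (n - k))); last by rewrite IH ffactSS natrM exprS; ring.
rewrite mulr_sumr; apply: eq_bigr => k _; rewrite lift0 subSS ffactSS.
rewrite mulnA [('C(_, _) * _)%N]mulnC -mul_bin_diag /= exprS -!mulnA !natrM; ring.
Qed.

(** The masses at the points k / n of a discrete measure that approximates the
    measure with moments s. *)
Definition bweight s n k : R := 'C(n, k)%:R * momf s ('X^k * (1 - 'X) ^+ (n - k)).

Lemma sum_bweight_ffact s n m :
  \sum_(k < n.+1) bweight s n k * (k ^_ m)%:R = (n ^_ m)%:R * s m.
Proof.
have [nm|mn] := ltnP n m.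
  rewrite ffact_small// mul0r big1// => k _.
  by rewrite ffact_small ?mulr0// (leq_ltn_trans _ nm)// -ltnS.
transitivity (momf s (\sum_(k < n.+1) ('C(n, k) * k ^_ m)%:R *
    ('X^k * (1 - 'X) ^+ (n - k)))).
  rewrite linear_sum; apply: eq_bigr => k _.
  by rewrite mulr_natl linearMn/= -[RHS]mulr_natl natrM /bweight; ring.
by rewrite sum_binomial_ffact addrC subrK expr1n mulr1 mulr_natl linearMn/=
  momfXn mulr_natl.
Qed.

Lemma cvg_ffact_ratio m :
  (fun n => (n.+1 ^_ m)%:R / n.+1%:R ^+ m : R) @ \oo --> (1 : R).
Proof.
elim: m => [|m IH]; first by under eq_fun do rewrite ffactn0 expr0 divr1; exact: cvg_cst.
have -> : (fun n => (n.+1 ^_ m.+1)%:R / n.+1%:R ^+ m.+1 : R) =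
    (fun n => (n.+1 ^_ m)%:R / n.+1%:R ^+ m : R) \* (fun n => 1 - m%:R * harmonic n).
  apply/funext => n /=; have n0 : n.+1%:R != 0 :> R by rewrite pnatr_eq0.
  have -> : (n.+1 ^_ m.+1)%:R = (n.+1 ^_ m)%:R * (n.+1%:R - m%:R) :> R.
    have [nm|mn] := ltnP n.+1 m; first by rewrite !ffact_small ?mul0r// ltnW.
    by rewrite ffactnSr natrM natrB.
  rewrite exprS; field; rewrite expf_neq0//=; rewrite -[1 + _]addrC natr1 n0//.
suff : (fun n => (n.+1 ^_ m)%:R / n.+1%:R ^+ m : R) \* (fun n => 1 - m%:R * harmonic n)
    @ \oo --> 1 * (1 - m%:R * 0 : R) by rewrite mulr0 subr0 mulr1.
apply: cvgM => //; apply: cvgB; first exact: cvg_cst.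
by apply: cvgM; [exact: cvg_cst|exact: cvg_harmonic].
Qed.

(** The factorial moments of the weights are known exactly.  The power moments
    follow by induction from the identity k * k ^_ i = k ^_ (i + 1) + i * k ^_ i,
    whose last term is of lower order after division by the power of n. *)
Lemma cvg_bweight_moment s m :
  (fun n => \sum_(k < n.+2) bweight s n.+1 k * (k%:R / n.+1%:R) ^+ m) @ \oo --> s m.
Proof.
pose t j m n : R := \sum_(k < n.+2) bweight s n.+1 k * (k%:R ^+ j * (k ^_ m)%:R)
   / n.+1%:R ^+ (j + m).
suff tE j i : t j i @ \oo --> s (j + i)%N.
  have := tE m 0%N; rewrite addn0; apply: cvg_trans; apply: near_eq_cvg.
  apply: nearW => n; apply: eq_bigr => k _.
  by rewrite ffactn0 mulr1 addn0 -mulrA -expr_div_n.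
elim: j i => [|j IH] i.
  have -> : t 0%N i = (fun n => (n.+1 ^_ i)%:R / n.+1%:R ^+ i * s i).
    apply/funext => n; rewrite /t -mulr_suml [RHS]mulrAC; congr (_ / _).
    by rewrite -sum_bweight_ffact; apply: eq_bigr => k _; rewrite mul1r.
  suff : (fun n => (n.+1 ^_ i)%:R / n.+1%:R ^+ i * s i) @ \oo --> 1 * s i.
    by rewrite mul1r.
  by apply: cvgM; [exact: cvg_ffact_ratio|exact: cvg_cst].
have -> : t j.+1 i = (fun n => t j i.+1 n + i%:R * harmonic n * t j i n).
  apply/funext => n; rewrite /t mulr_sumr -big_split/=; apply: eq_bigr => k _.
  have n0 : n.+1%:R != 0 :> R by rewrite pnatr_eq0.
  have -> : (k ^_ i.+1)%:R = (k ^_ i)%:R * (k%:R - i%:R) :> R.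
    have [nm|mn] := ltnP k i; first by rewrite !ffact_small ?mul0r// ltnW.
    by rewrite ffactnSr natrM natrB.
  rewrite addSn addnS !exprS; field; rewrite expf_neq0//=; rewrite -[1 + _]addrC natr1 n0//.
suff : (fun n => t j i.+1 n + i%:R * harmonic n * t j i n) @ \oo -->
    s (j + i.+1)%N + i%:R * 0 * s (j + i)%N by rewrite mulr0 mul0r addr0 -addSnnS.
apply: cvgD => //; apply: cvgM => //.
by apply: cvgM; [exact: cvg_cst|exact: cvg_harmonic].
Qed.

End bernstein_weights.

(** * Limits of nondecreasing functions along an ultrafilter *)

Section unit_nondecreasing.
Variable R : realType.
Local Notation mu := (@lebesgue_measure R).
Implicit Types f : R -> R.

Definition unit_nd f := nondecreasing_fun f /\ forall u, 0 <= f u <= 1.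

Lemma unit_ndX f m : unit_nd f -> unit_nd (fun u => f u ^+ m).
Proof.
move=> [fnd f01]; split=> [u v uv|u]; have /andP[fu0 fu1] := f01 u.
  by rewrite lerXn2r ?nnegrE//; [have /andP[] := f01 v|exact: fnd].
by rewrite exprn_ge0// exprn_ile1.
Qed.

Lemma unit_nd_integrable f a b : unit_nd f ->
  mu.-integrable `[a, b[%classic (EFin \o f).
Proof.
move=> [fnd f01]; apply: measurable_bounded_integrable => //.
- by rewrite /= lebesgue_measure_itv; case: ifP => _; rewrite ?ltry// -EFinB ltry.
- exact: nondecreasing_measurable.
exists 1; split => // x x1 u _ /=; have /andP[f0 f1] := f01 u.
by rewrite ger0_norm// (le_trans f1)// ltW.
Qed.

Lemma lebesgue_measure_co (a b : R) : a <= b -> fine (mu `[a, b[%classic) = b - a.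
Proof.
by rewrite lebesgue_measure_itv/= lte_fin le_eqVlt => /orP[/eqP->|->//];
  rewrite ltxx subrr.
Qed.

Lemma unit_nd_integral_split f a b c : unit_nd f -> a <= b -> b <= c ->
  \int[mu]_(u in `[a, c[) f u = \int[mu]_(u in `[a, b[) f u + \int[mu]_(u in `[b, c[) f u.
Proof.
move=> fu ab bc; rewrite -Rintegral_setU//.
- by congr Rintegral; apply/seteqP; split => u /=; rewrite !in_itv/=;
    have [ub|ub] := ltP u b; lra.
- rewrite (_ : _ `|` _ = `[a, c[%classic); first exact: unit_nd_integrable.
  by apply/seteqP; split => u /=; rewrite !in_itv/=; have [ub|ub] := ltP u b; lra.
- by apply/disj_setPS => u [] /=; rewrite !in_itv/=; lra.
Qed.

Lemma unit_nd_integral_bounds f a b : unit_nd f -> a <= b ->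
  f a * (b - a) <= \int[mu]_(u in `[a, b[) f u <= f b * (b - a).
Proof.
move=> fu ab; have [fnd f01] := fu.
have icst c : mu.-integrable `[a, b[%classic (EFin \o cst c).
  apply: measurable_bounded_integrable => //.
    by rewrite /= lebesgue_measure_itv; case: ifP => _; rewrite ?ltry// -EFinB ltry.
  by exists `|c|; split => // x cx u _; exact: ltW.
rewrite -lebesgue_measure_co// -!Rintegral_cst//; apply/andP; split.
  apply: le_Rintegral => //; [exact: icst|exact: unit_nd_integrable|].
  by move=> u /=; rewrite in_itv/= => /andP[au ub]; exact: fnd.
apply: le_Rintegral => //; [exact: unit_nd_integrable|exact: icst|].
by move=> u /=; rewrite in_itv/= => /andP[au ub]; apply: fnd; exact: ltW.
Qed.

Definition left_sum f (a : R) N := a / N%:R * \sum_(j < N) f (j%:R * (a / N%:R)).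

Lemma cvg_between (F : set_system nat) (FF : ProperFilter F) (u : nat -> R) l a b :
  u @ F --> l -> (forall n, a <= u n <= b) -> a <= l <= b.
Proof.
move=> ul uab; apply/andP; split.
  by apply: (@closed_cvg _ _ F FF u (fun x => a <= x) (@closed_ge R a) _ l ul);
    apply: nearW => n; have /andP[] := uab n.
by apply: (@closed_cvg _ _ F FF u (fun x => x <= b) (@closed_le R b) _ l ul);
    apply: nearW => n; have /andP[] := uab n.
Qed.

(** The bound does not depend on f: the errors over the subintervals telescope to
    (a / N) (f a - f 0), and f takes its values in [0, 1]. *)
Lemma left_sum_error f a N : unit_nd f -> 0 <= a -> (0 < N)%N ->
  0 <= \int[mu]_(u in `[0, a[) f u - left_sum f a N <= a / N%:R.
Proof.
move=> fu a0 N0; rewrite /left_sum; move hE : (a / N%:R) => h.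
have h0 : 0 <= h by rewrite -hE divr_ge0.
have step k : h * \sum_(j < k) f (j%:R * h) <= \int[mu]_(u in `[0, k%:R * h[) f u <=
    h * \sum_(j < k) f (j%:R * h) + h * (f (k%:R * h) - f 0).
  elim: k => [|k /andP[IH1 IH2]].
    by rewrite big_ord0 mul0r set_itv_ge ?bnd_simp ?ltxx// Rintegral_set0 subrr !mulr0 addr0 lexx.
  have kS : k%:R * h <= k.+1%:R * h by rewrite ler_wpM2r// ler_nat.
  have := unit_nd_integral_bounds fu kS.
  rewrite (unit_nd_integral_split fu (mulr_ge0 (ler0n _ k) h0) kS) -mulrBl -natrB//.
  rewrite subSnn mul1r big_ord_recr/=.
  move: (\sum_(j < k) f (j%:R * h)) (f 0) (f (k%:R * h)) (f (k.+1%:R * h))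
    (\int[mu]_(u in `[0, k%:R * h[) f u)
    (\int[mu]_(u in `[k%:R * h, k.+1%:R * h[) f u) IH1 IH2 => S f0 fk fk1 I J.
  lra.
have := step N.
have -> : N%:R * h = a by rewrite -hE mulrC divfK// pnatr_eq0 -lt0n.
have [_ f01] := fu; have := f01 0; have := f01 a => fa f0 /andP[L U].
apply/andP; split; first by rewrite subr_ge0.
rewrite lerBlDl (le_trans U)// lerD2l -[leRHS]mulr1 ler_wpM2l//; lra.
Qed.

(** Dominated convergence fails along general filters, but here the integrals are
    approximated, uniformly in n, by Riemann sums, and these involve finitely many
    points only. *)
Lemma unit_nd_cvg_integral (F : set_system nat) (FF : ProperFilter F)
    (f_ : nat -> R -> R) f a l : 0 <= a -> (forall n, unit_nd (f_ n)) -> unit_nd f ->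
  (forall u, f_ ^~ u @ F --> f u) ->
  (fun n => \int[mu]_(u in `[0, a[) f_ n u) @ F --> l ->
  \int[mu]_(u in `[0, a[) f u = l.
Proof.
move=> a0 f_u fu f_f f_l.
have bnd N : (0 < N)%N -> `|\int[mu]_(u in `[0, a[) f u - l| <= a / N%:R.
  move=> N0; have sum_cvg : (fun n => left_sum (f_ n) a N) @ F --> left_sum f a N.
    apply: cvgM; first exact: cvg_cst.
    by apply: cvg_big => [|i _]; [exact: add_continuous|exact: f_f].
  have : 0 <= l - left_sum f a N <= a / N%:R.
    apply: (@cvg_between F FF
      (fun n => \int[mu]_(u in `[0, a[) f_ n u - left_sum (f_ n) a N)).
      exact: cvgB f_l sum_cvg.
    by move=> n; exact: left_sum_error.
  by have := left_sum_error fu a0 N0; rewrite ler_norml; lra.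
apply/eqP; rewrite -subr_eq0 -normr_le0 leNgt; apply/negP => d0.
set d := `|_| in d0; have := bnd (Num.truncn (a / d)).+1 isT.
rewrite -/d leNgt => /negP; apply; rewrite ltr_pdivrMr// mulrC -ltr_pdivrMr//.
by rewrite truncnS_gt.
Qed.

Lemma ultra_map (T U : Type) (g : T -> U) (F : set_system T) :
  UltraFilter F -> UltraFilter (g @ F).
Proof.
move=> FU; split; first exact: fmap_proper_filter.
move=> G GF FG; apply/seteqP; split => A /=; [move=> GA|exact: FG].
have [//|nA] := in_ultra_setVsetC (g @^-1` A) FU.
have GnA : G (~` A) by exact: FG.
have : G (A `&` ~` A) by exact: filterI.
by rewrite setICr => /filter_not_empty.
Qed.

(** Along an ultrafilter each sequence f_ n u converges, by compactness of [0, 1];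
    no subsequence has to be extracted. *)
Lemma unit_nd_ultra_limit (f_ : nat -> R -> R) : (forall n, unit_nd (f_ n)) ->
  exists F : set_system nat, exists f, [/\ ProperFilter F, \oo `<=` F, unit_nd f &
    forall u, f_ ^~ u @ F --> f u].
Proof.
move=> f_u; have [F [FU ooF]] := @ultraFilterLemma nat \oo _.
have FP : ProperFilter F by exact: ultra_proper.
have lim u : exists y : R, 0 <= y <= 1 /\ f_ ^~ u @ F --> y.
  have := @segment_compact R 0 1; rewrite compact_ultra => /(_ _ (ultra_map (f_ ^~ u) FU)).
  case; first by apply: nearW => n /=; rewrite in_itv/=; have [_] := f_u n; exact.
  by move=> y [] /=; rewrite in_itv/= => y01 fy; exists y.
have [f ff] := choice lim.
exists F, f; split => //; last by move=> u; have [] := ff u.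
split=> [u v uv|u]; last by have [] := ff u.
have [_ fu] := ff u; have [_ fv] := ff v.
rewrite -subr_ge0; apply: (@closed_cvg _ _ F FP (f_ ^~ v \- f_ ^~ u) (fun x => 0 <= x)
  (@closed_ge R 0) _ _ (cvgB fv fu)).
by apply: nearW => n /=; rewrite subr_ge0; have [+ _] := f_u n; exact.
Qed.

End unit_nondecreasing.

(** * The Hausdorff moment problem *)

Section hausdorff.
Variable R : realType.
Local Notation mu := (@lebesgue_measure R).

Section quantile.
Variables (N : nat) (w : nat -> R).
Hypotheses (N_gt0 : (0 < N)%N) (w_ge0 : forall k, 0 <= w k).

Let P k := \sum_(i < k) w i.

Let P_nd j k : (j <= k)%N -> P j <= P k.
Proof.
move=> /subnK <-; elim: (k - j)%N => [//|n IH].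
by rewrite addSn /P big_ord_recr/= (le_trans IH)// lerDl.
Qed.

(** The quantile function of the discrete measure with mass w k at k / N: it maps
    Lebesgue measure on the interval from 0 to the total mass to that measure. *)
Definition quantile (u : R) : R := (\sum_(1 <= k < N.+1) (P k <= u)%R%:R) / N%:R.

Lemma quantile_unit_nd : unit_nd quantile.
Proof.
have N0 : 0 < N%:R :> R by rewrite ltr0n.
split=> [u v uv|u].
  rewrite ler_pM2r ?invr_gt0//; apply: ler_sum => k _.
  by rewrite ler_nat; case: (leP _ u) => // /le_trans ->.
rewrite divr_ge0 ?sumr_ge0//= ler_pdivrMr// mul1r.
apply: (@le_trans _ _ (\sum_(1 <= k < N.+1) 1)).
  by apply: ler_sum => k _; rewrite lern1 leq_b1.
by rewrite sumr_const_nat subSS subn0.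
Qed.

Lemma quantileE k u : (k <= N)%N -> P k <= u < P k.+1 -> quantile u = k%:R / N%:R.
Proof.
move=> kN /andP[Pu uP]; congr (_ / _).
rewrite (@big_cat_nat _ _ _ k.+1)//= [X in _ + X]big_nat_cond [X in _ + X]big1 ?addr0; last first.
  move=> j /andP[/andP[kj _] _].
  by rewrite leNgt (lt_le_trans uP)// P_nd.
rewrite big_nat_cond (eq_bigr (fun=> 1)); last first.
  by move=> j /andP[/andP[_ jk] _]; rewrite (le_trans _ Pu)// P_nd.
by rewrite -big_nat_cond sumr_const_nat subSS subn0.
Qed.

Lemma integral_quantile m :
  \int[mu]_(u in `[0, P N.+1[) quantile u ^+ m = \sum_(k < N.+1) w k * (k%:R / N%:R) ^+ m.
Proof.
have qm := unit_ndX m quantile_unit_nd.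
have P0 : P 0%N = 0 by rewrite /P big_ord0.
suff H n : (n <= N.+1)%N -> \int[mu]_(u in `[0, P n[) quantile u ^+ m =
  \sum_(k < n) w k * (k%:R / N%:R) ^+ m by exact: H.
elim: n => [_|k IH kN].
  by rewrite big_ord0 P0 set_itv_ge ?bnd_simp ?ltxx// Rintegral_set0.
have P0k : 0 <= P k by rewrite -P0 P_nd.
rewrite (unit_nd_integral_split qm P0k (P_nd (leqnSn k))) IH ?(ltnW kN)//.
rewrite big_ord_recr/=; congr (_ + _).
rewrite (@eq_Rintegral _ _ _ mu _ (fun=> (k%:R / N%:R) ^+ m)).
  rewrite Rintegral_cst// lebesgue_measure_co ?P_nd// /P big_ord_recr/=.
  by rewrite addrAC subrr add0r mulrC.
by move=> u; rewrite inE/= in_itv/= => Pu; rewrite (quantileE _ Pu).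
Qed.

End quantile.

(** The measure with moments s is obtained as the image of Lebesgue measure under
    an ultrafilter limit of the quantile functions of the Bernstein weights.  Its
    total mass is s 0, so the domain of these functions is [0, s 0[. *)
Lemma hausdorff_moment (s : nat -> R) :
  (forall j k, 0 <= momf s ('X^j * (1 - 'X) ^+ k)) ->
  exists f, unit_nd f /\ forall m, \int[mu]_(u in `[0, s 0%N[) f u ^+ m = s m.
Proof.
move=> s_ge0; pose f_ n := quantile n.+1 (bweight s n.+1).
have w_ge0 n k : 0 <= bweight s n k by rewrite mulr_ge0.
have f_u n : unit_nd (f_ n) by exact: quantile_unit_nd.
have [F [f [FP ooF fu f_f]]] := unit_nd_ultra_limit f_u.
exists f; split => // m.
have s0 : 0 <= s 0%N by have := s_ge0 0%N 0%N; rewrite !expr0 mulr1 momf1.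
have sumw n : \sum_(i < n.+2) bweight s n.+1 i = s 0%N.
  have := sum_bweight_ffact s n.+1 0; rewrite ffactn0 mul1r => <-.
  by apply: eq_bigr => i _; rewrite ffactn0 mulr1.
apply: (@unit_nd_cvg_integral _ F FP (fun n u => f_ n u ^+ m)) => //.
- by move=> n; exact: unit_ndX.
- exact: unit_ndX.
- by move=> u; exact: continuous_cvg (@exprn_continuous R m (f u)) (f_f u).
- have -> : (fun n => \int[mu]_(u in `[0, s 0%N[) f_ n u ^+ m) =
    (fun n => \sum_(k < n.+2) bweight s n.+1 k * (k%:R / n.+1%:R) ^+ m).
    by apply/funext => n; rewrite -(sumw n) integral_quantile.
  by move=> A /(cvg_bweight_moment (m := m)) /ooF.
Qed.

End hausdorff.

(** * Finite measures carried by a compact interval *)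

Section compactly_supported.
Variable R : realType.
Local Notation measR := (measurableTypeR R).
Implicit Types (nu : {finite_measure set measR -> \bar R}) (p q : {poly R}) (M : R).

Definition supported nu M := nu (~` `[0, M]%classic) = 0%E.

Lemma measurable_horner (D : set measR) p : measurable_fun D (horner p : measR -> R).
Proof.
apply: measurable_funTS; apply: (continuous_measurable_fun (f := horner p)).
exact: continuous_horner.
Qed.

Lemma horner_bounded_itv p M : exists C, forall x, x \in `[0, M] -> `|p.[x]| <= C.
Proof.
exists (\sum_(i < size p) `|p`_i| * M ^+ i) => x; rewrite in_itv/= => /andP[x0 xM].
rewrite horner_coef (le_trans (ler_norm_sum _ _ _))//; apply: ler_sum => i _.
rewrite normrM ler_wpM2l// normrX ger0_norm// lerXn2r ?nnegrE//.
exact: le_trans xM.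
Qed.

Lemma horner_integrable nu M p : nu.-integrable `[0, M]%classic (EFin \o horner p).
Proof.
apply: measurable_bounded_integrable => //.
- by rewrite -ge0_fin_numE//; exact: fin_num_measure.
- exact: measurable_horner.
have [C pC] := horner_bounded_itv p M.
exists C; split; first exact: num_real.
by move=> y Cy x /= x0M; rewrite (le_trans (pC _ x0M))// ltW.
Qed.

Definition pint nu M p : R := \int[nu]_(x in `[0, M]) p.[x].

Fact pint_is_scalar nu M : scalar (pint nu M).
Proof.
move=> a p q; rewrite /pint -RintegralZl//; last exact: horner_integrable.
rewrite -RintegralD//; [| |exact: horner_integrable].
  by apply: eq_Rintegral => x _; rewrite hornerD hornerZ.
rewrite [X in integrable _ _ X](_ : _ = EFin \o horner (a *: p)).
  exact: horner_integrable.
by apply/funext => x /=; rewrite hornerZ.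
Qed.

HB.instance Definition _ nu M :=
  GRing.isLinear.Build R {poly R} R _ (pint nu M) (pint_is_scalar nu M).

Lemma pint_momf nu M p : pint nu M p = momf (fun n => pint nu M 'X^n) p.
Proof.
by apply: (@eq_on_Xn _ (pint nu M) (momf (fun n => pint nu M 'X^n))) => n /=;
  rewrite momfXn.
Qed.

Lemma pint_ge0 nu M p : (forall x, 0 <= x <= M -> 0 <= p.[x]) -> 0 <= pint nu M p.
Proof. by move=> p0; apply: Rintegral_ge0 => x /=; rewrite in_itv/=; exact: p0. Qed.

Lemma pint_integral nu M p : supported nu M ->
  (\int[nu]_(x in `[0%R, +oo[) (p.[x])%:E)%E = (pint nu M p)%:E.
Proof.
move=> nuM; have mI : measurable (`[0%R, +oo[%classic : set measR) by [].
have mN : measurable (~` `[0, M]%classic : set measR) by exact: measurableC.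
have DN : `[0%R, +oo[%classic `\` ~` `[0, M]%classic = `[0, M]%classic :> set measR.
  by apply/seteqP; split => x; rewrite /= !in_itv/= andbT; lra.
rewrite (negligible_integral mN mI) ?DN//.
  by rewrite /pint fineK//; apply: integrable_fin_num => //; exact: horner_integrable.
rewrite (negligible_integrable mN) ?DN//; first exact: horner_integrable.
by apply/measurable_EFinP; exact: measurable_horner.
Qed.

(** The complement of the support is covered by countably many null intervals with
    rational end points. *)
Lemma msuppC_null nu : nu.-negligible (~` msupp nu).
Proof.
pose F (n : nat) : set measR := if @unpickle (rat * rat)%type n is Some r
  then if `[< nu `]ratr r.1, ratr r.2[%classic = 0%E >] then `]ratr r.1, ratr r.2[%classic
  else set0 else set0.
apply: (@negligibleS _ _ _ _ (\bigcup_n F n)); last first.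
  apply: negligible_bigcup => n; rewrite /F.
  case: unpickle => [r|]; last exact: negligible_set0.
  case: asboolP => [r0|_]; last exact: negligible_set0.
  by apply/negligibleP.
move=> x /= /existsNP[U] /not_implyP[oU] /not_implyP[Ux] /negP.
rewrite -leNgt measure_le0 => /eqP U0.
have /nbhs_ballP[e /= e0 eU] : nbhs x U by exact: open_nbhs_nbhs.
have [p /andP[xp px]] : exists p : rat, x - e < ratr p < x.
  have := @rat_in_itvoo R (x - e) x; rewrite ltrBlDr ltrDl => /(_ e0)[p].
  by rewrite in_itv/=; exists p.
have [q /andP[xq qx]] : exists q : rat, x < ratr q < x + e.
  have := @rat_in_itvoo R x (x + e); rewrite ltrDl => /(_ e0)[q].
  by rewrite in_itv/=; exists q.
have [n nE] : exists n, @unpickle (rat * rat)%type n = Some (p, q).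
  by eexists; exact: pickleK.
exists n; first exact: I.
rewrite /F nE; case: asboolP => [_|[]].
  by rewrite /= in_itv/= px xq.
apply: (subset_measure0 _ _ _ U0) => //; first exact: open_measurable.
move=> y /=; rewrite in_itv/= => /andP[py yq]; apply: eU; rewrite /ball/= ltr_norml; lra.
Qed.

Lemma compact_msupp_supported nu : nu `]-oo, 0[%classic = 0%E -> compact (msupp nu) ->
  exists2 M, 0 <= M & supported nu M.
Proof.
move=> nu0 /compact_bounded[M [_ /(_ (`|M| + 1))]].
have Mlt : M < `|M| + 1 by rewrite (le_lt_trans (ler_norm M))// ltrDl.
move=> /(_ Mlt) bM.
exists (`|M| + 1); first by rewrite addr_ge0.
suff : nu.-negligible (~` `[0, `|M| + 1]%classic).
  by move/negligibleP; apply; exact: measurableC.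
apply: (@negligibleS _ _ _ _ (`]-oo, 0[%classic `|` ~` msupp nu : set measR)) => [x /=|].
  rewrite in_itv/= => /negP; rewrite negb_and -!ltNge => /orP[x0|xM].
    by left; rewrite /= in_itv.
  by right=> /= /bM /=; rewrite leNgt (lt_le_trans xM)// ler_norm.
by apply: negligibleU; [apply/negligibleP|exact: msuppC_null].
Qed.

Lemma supported_msupp nu M : supported nu M -> msupp nu `<=` `[0, M]%classic.
Proof.
move=> nuM x nux; apply: contrapT => xM.
have : open (~` `[0, M]%classic : set R) by apply: closed_openC; exact: itv_closed.
by move=> /nux /(_ xM); rewrite nuM ltxx.
Qed.

Lemma supported_compact_msupp nu M : supported nu M -> compact (msupp nu).
Proof.
move=> nuM; apply: (subclosed_compact _ (@segment_compact R 0 M) (supported_msupp nuM)).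
rewrite -[msupp nu]setCK; apply: open_closedC; rewrite openE => x /=.
move=> /existsNP[U] /not_implyP[oU] /not_implyP[Ux U0].
apply: (filterS _ (open_nbhs_nbhs (conj oU Ux))) => y Uy /= /(_ U oU Uy); exact: U0.
Qed.

Lemma supported_lt0 nu M : supported nu M -> nu `]-oo, 0[%classic = 0%E.
Proof.
move=> nuM; apply: subset_measure0 nuM => //; first exact: measurableC.
by move=> x /=; rewrite !in_itv/=; lra.
Qed.

Lemma supported_measure_setI nu M (A : set measR) : supported nu M -> measurable A ->
  nu A = nu (A `&` `[0, M]%classic).
Proof.
move=> nuM mA; have mI : measurable (`[0, M]%classic : set measR) by [].
rewrite [LHS](measureDI nu mA mI) [X in (X + _)%E](_ : _ = 0%E) ?add0e//.
apply: subset_measure0 nuM; [exact: measurableD|exact: measurableC|by move=> x []].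
Qed.

Lemma supportedW nu M M' : M <= M' -> supported nu M -> supported nu M'.
Proof.
move=> MM' nuM; apply: subset_measure0 nuM => //; [exact: measurableC..|].
by move=> x /=; rewrite !in_itv/=; lra.
Qed.

(** Markov's inequality for x^n. *)
Lemma pint_tail nu M (r : R) n : 0 <= r -> supported nu M ->
  r ^+ n * fine (nu `]r, +oo[%classic) <= pint nu M 'X^n.
Proof.
move=> r0 nuM; have mI : measurable (`[0, M]%classic : set measR) by [].
have mA : measurable (`]r, +oo[%classic : set measR) by [].
have iA : nu.-integrable `[0, M]%classic (EFin \o (\1_(`]r, +oo[%classic) : measR -> R)).
  apply: measurable_bounded_integrable => //.
  - by rewrite -ge0_fin_numE//; exact: fin_num_measure.
  - by exists 1; split => // y y1 x _ /=; rewrite indicE ger0_norm// (le_trans _ (ltW y1))// lern1 leq_b1.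
have -> : fine (nu `]r, +oo[%classic) = \int[nu]_(x in `[0, M]) \1_(`]r, +oo[%classic : set measR) x.
  by rewrite /Rintegral integral_indic//; congr fine; exact: supported_measure_setI.
rewrite -RintegralZl//; apply: le_Rintegral => //.
- rewrite [X in integrable _ _ X](_ : _ = (fun x => (r ^+ n)%:E * (EFin \o (\1_(`]r, +oo[%classic) : measR -> R)) x)%E).
    exact: integrableZl.
  by apply/funext => x /=; rewrite EFinM.
- exact: horner_integrable.
move=> x /=; rewrite in_itv/= => /andP[x0 xM]; rewrite hornerXn indicE.
have [|_] := boolP (x \in _); last by rewrite mulr0 exprn_ge0.
by rewrite mem_setE in_itv/= andbT mulr1 => /ltW rx; rewrite lerXn2r ?nnegrE.
Qed.

End compactly_supported.

(** * A measure on a compact interval is determined by its moments *)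

Section moment_uniqueness.
Variable R : realType.
Local Notation measR := (measurableTypeR R).
Implicit Types (nu : {finite_measure set measR -> \bar R}) (p q : {poly R}) (M : R).

(** Bernoulli's inequality for s / r, with r < s < 1, gives n r^n <= s^n / d with
    d = s / r - 1. *)
Lemma cvg_natM_expr (r : R) : 0 <= r < 1 -> (fun n => n%:R * r ^+ n) @ \oo --> 0.
Proof.
move=> /andP[]; rewrite le_eqVlt => /orP[/eqP <- _|r0 r1].
  under eq_fun do rewrite expr0n -natrM.
  by apply: cvg_near_cst; near=> n; rewrite gtn_eqF ?muln0//; near: n; exists 1%N.
pose s := (1 + r) / 2; pose d := s / r - 1.
have s0 : 0 < s by rewrite /s; lra.
have d0 : 0 < d by rewrite subr_gt0 ltr_pdivlMr// mul1r /s; lra.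
have s1 : `|s| < 1 by rewrite gtr0_norm// /s; lra.
apply: (@squeeze_cvgr _ _ _ _ (fun=> 0) (fun n => d^-1 * s ^+ n)).
- near=> n; rewrite mulr_ge0 ?exprn_ge0 ?(ltW r0)//=.
  rewrite ler_pdivlMl// mulrA -ler_pdivlMr ?exprn_gt0// -expr_div_n.
  have /(bernoulli_le n) : -1 <= d by lra.
  rewrite [1 + d]addrC subrK; apply: le_trans; rewrite [d * _]mulrC; lra.
- exact: cvg_cst.
- suff : (fun n => d^-1 * s ^+ n) @ \oo --> d^-1 * 0 by rewrite mulr0.
  by apply: cvgM; [exact: cvg_cst|exact: cvg_expr].
Unshelve. all: by end_near. Qed.

(** On [0, 1] these polynomials converge to the indicator of y < 1/2, including at
    y = 1/2, because n 2^n y^n = n (2 y)^n tends to 0 if y < 1/2 and to infinity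
    otherwise. *)
Definition stone (y : R) n : R := (1 - y ^+ n) ^+ (n * 2 ^ n).

Lemma stone_itv y n : 0 <= y <= 1 -> 0 <= stone y n <= 1.
Proof.
move=> /andP[y0 y1]; have := exprn_ile1 n y0 y1; have := exprn_ge0 n y0.
by move=> yn0 yn1; rewrite exprn_ge0 ?exprn_ile1//; lra.
Qed.

(** Bernoulli's inequality gives both bounds: (1 - z)^N >= 1 - N z directly, and
    (1 - z)^N <= 1 / (1 + N z) from (1 - z)^N (1 + z)^N <= 1. *)
Lemma cvg_stone y : 0 <= y <= 1 -> stone y @ \oo --> ((y < 2^-1)%R%:R : R).
Proof.
move=> y01; have /andP[y0 y1] := y01.
have E n : (n * 2 ^ n)%:R * y ^+ n = n%:R * (2 * y) ^+ n :> R.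
  by rewrite natrM natrX exprMn mulrA.
have yn n : 0 <= y ^+ n <= 1 by rewrite exprn_ge0 ?exprn_ile1.
have [yh|yh] := ltP y 2^-1.
  apply: (@squeeze_cvgr _ _ _ _ (fun n => 1 - n%:R * (2 * y) ^+ n) (fun=> 1)).
  - apply: nearW => n; have /andP[_ ->] := stone_itv n y01.
    have /(bernoulli_le (n * 2 ^ n)) : -1 <= - y ^+ n by have := yn n; lra.
    by rewrite mulrN E andbT.
  - suff : (fun n => 1 - n%:R * (2 * y) ^+ n) @ \oo --> (1 - 0 : R) by rewrite subr0.
    by apply: cvgB; [exact: cvg_cst|apply: cvg_natM_expr; lra].
  - exact: cvg_cst.
apply: (@squeeze_cvgr _ _ _ _ (fun=> 0) (@harmonic R)).
- apply: nearW => n; have /andP[-> _] := stone_itv n y01.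
  have yn1 := yn n; have ynp : 0 <= y ^+ n by have /andP[] := yn1.
  rewrite /= /harmonic -[leRHS]mul1r ler_pdivlMr ?ltr0n//.
  apply: (@le_trans _ _ ((1 - y ^+ n) ^+ (n * 2 ^ n) * (1 + y ^+ n) ^+ (n * 2 ^ n))).
    rewrite ler_wpM2l//; first by apply: exprn_ge0; lra.
    have /(bernoulli_le (n * 2 ^ n)) : -1 <= y ^+ n by lra.
    apply: le_trans; rewrite E -natr1 addrC lerD2l -[leLHS]mulr1 ler_wpM2l//.
    by apply: exprn_ege1; lra.
  by rewrite -exprMn -subr_sqr expr1n exprn_ile1//; nra.
- exact: cvg_cst.
- exact: cvg_harmonic.
Qed.

(** The affine map inside sends a to 1/2 and [0, M] into [0, 1]. *)
Definition stone_poly (M a : R) (n : nat) : {poly R} :=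
  let Y := (2^-1)%:P + (2 * (`|a| + M + 1))^-1 *: ('X - a%:P) in
  (1 - Y ^+ n) ^+ (n * 2 ^ n).

Lemma stone_polyE M a x : 0 <= M -> x \in `[0, M] ->
  exists y, [/\ 0 <= y <= 1, (y < 2^-1) = (x < a) & forall n, (stone_poly M a n).[x] = stone y n].
Proof.
rewrite in_itv/= => M0 /andP[x0 xM]; pose D := `|a| + M + 1.
have D0 : 0 < 2 * D by rewrite /D; have := normr_ge0 a; lra.
exists (2^-1 + (2 * D)^-1 * (x - a)); split.
- suff /andP[d1 d2]: - 2^-1 <= (2 * D)^-1 * (x - a) <= 2^-1 by apply/andP; lra.
  rewrite mulrC ler_pdivlMr// ler_pdivrMr// /D; have := ler_norm a.
  by have := ler_norm (- a); rewrite normrN; lra.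
- by rewrite gtrDl pmulr_rlt0 ?invr_gt0// subr_lt0.
- by move=> k; rewrite /stone_poly /stone !(hornerE, horner_exp).
Qed.

Lemma cvg_pint_indic nu M (p_ : nat -> {poly R}) (A : set measR) : supported nu M ->
  measurable A -> (forall n x, x \in `[0, M] -> 0 <= (p_ n).[x] <= 1) ->
  (forall x, x \in `[0, M] -> (fun n => (p_ n).[x]) @ \oo --> (\1_A x : R)) ->
  (fun n => (pint nu M (p_ n))%:E) @ \oo --> nu A.
Proof.
move=> nuM mA p01 pA; have mI : measurable (`[0, M]%classic : set measR) by [].
have -> : nu A = (\int[nu]_(x in `[0%R, M]) (\1_A x)%:E)%E.
  by rewrite integral_indic//; exact: supported_measure_setI.
have -> : (fun n => (pint nu M (p_ n))%:E) =
    (fun n => \int[nu]_(x in `[0%R, M]) ((p_ n).[x])%:E)%E.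
  apply/funext => n; rewrite /pint fineK//.
  by apply: integrable_fin_num => //; exact: horner_integrable.
have := @dominated_convergence _ measR R nu `[0, M]%classic mI
  (fun n x => ((p_ n).[x])%:E) (fun x => (\1_A x)%:E) (cst 1%E).
case=> //.
- by move=> n; apply/measurable_EFinP; exact: measurable_horner.
- by apply/measurable_EFinP; exact: measurable_indic.
- apply: aeW => x xM; apply: cvg_EFin; first exact: nearW.
  exact: pA.
- exact: finite_measure_integrable_cst.
- apply: aeW => x n xM; have /andP[p0 p1] := p01 n x xM.
  by rewrite /= lee_fin ger0_norm.
Qed.

(** On [0, M] the base lies in [0, 1] and equals 1 at the point 1 only. *)
Definition peak_poly (M : R) (n : nat) : {poly R} :=
  (1 - ((M + 1)^-1 *: ('X - 1)) ^+ 2) ^+ n.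

Lemma cvg_pint_peak nu M : 0 <= M -> supported nu M ->
  (fun n => (pint nu M (peak_poly M n))%:E) @ \oo --> nu [set 1].
Proof.
move=> M0 nuM; pose z x := 1 - ((M + 1)^-1 * (x - 1)) ^+ 2.
have pE n x : (peak_poly M n).[x] = z x ^+ n.
  by rewrite /peak_poly /z !(hornerE, horner_exp).
have z01 x : x \in `[0, M] -> 0 <= z x <= 1.
  rewrite in_itv/= => /andP[x0 xM].
  have : -1 <= (M + 1)^-1 * (x - 1) <= 1.
    have D0 : 0 < M + 1 by lra.
    by rewrite mulrC ler_pdivlMr// ler_pdivrMr//; apply/andP; split; lra.
  rewrite /z; move: (_ * _) => t /andP[t1 t2].
  have : 0 <= (1 - t) * (1 + t) by rewrite mulr_ge0; lra.
  by have := sqr_ge0 t; rewrite expr2; lra.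
apply: cvg_pint_indic => // [n x xM|x xM].
  by rewrite pE; have /andP[z0 z1] := z01 x xM; rewrite exprn_ge0// exprn_ile1.
under eq_fun do rewrite pE.
rewrite indicE; have [->|x1] := eqVneq x 1.
  rewrite mem_set//= /z subrr mulr0 expr0n subr0.
  by under eq_fun do rewrite expr1n; exact: cvg_cst.
rewrite memNset; last by move=> /= /eqP; rewrite (negbTE x1).
apply: cvg_expr; have /andP[z0 z1] := z01 x xM.
rewrite ger0_norm// /z ltrBlDr ltrDl exprn_even_gt0//= mulf_neq0 ?subr_eq0//.
by rewrite invr_neq0// gt_eqF//; lra.
Qed.

Lemma cvg_pint_stone nu M a : 0 <= M -> supported nu M ->
  (fun n => (pint nu M (stone_poly M a n))%:E) @ \oo --> nu `]-oo, a[%classic.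
Proof.
move=> M0 nuM; apply: cvg_pint_indic => // [n x xM|x xM];
  have [y [y01 ya pE]] := stone_polyE a M0 xM; first by rewrite pE stone_itv.
under eq_fun do rewrite pE; rewrite indicE mem_setE in_itv/= -ya.
exact: cvg_stone.
Qed.

(** The constants d and d' are the moments of point masses at 1.  They are
    separated from the rest by polynomials that peak at 1; then polynomials that
    approximate the indicators of open left rays determine the measure. *)
Lemma supported_moments_unique nu nu' M d d' : 0 <= M ->
  supported nu M -> supported nu' M -> nu [set 1] = 0%E -> nu' [set 1] = 0%E ->
  (forall n, d + pint nu M 'X^n = d' + pint nu' M 'X^n) ->
  d = d' /\ forall A, measurable A -> nu A = nu' A.
Proof.
move=> M0 nuM nuM' nu1 nu1' nn'.
have eqp1 p : d * p.[1] + pint nu M p = d' * p.[1] + pint nu' M p.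
  rewrite (pint_momf nu) (pint_momf nu') horner_coef !mulr_sumr -!big_split/=.
  apply: eq_bigr => i _; rewrite expr1n mulr1.
  by rewrite [d * _]mulrC [d' * _]mulrC -!mulrDr nn'.
have peak1 n : (peak_poly M n).[1] = 1.
  by rewrite /peak_poly !(hornerE, horner_exp) subrr mulr0 expr0n subr0 expr1n.
have dd' : d = d'.
  have := cvg_pint_peak M0 nuM; rewrite nu1 => /fine_cvg/= h.
  have := cvg_pint_peak M0 nuM'; rewrite nu1' => /fine_cvg/= h'.
  suff /cvg_lim : (fun=> d - d') @ \oo --> (0 - 0 : R).
    by rewrite lim_cst// subrr => /(_ (@Rhausdorff R))/eqP; rewrite subr_eq0 => /eqP.
  rewrite (_ : (fun=> d - d') = (fun n => pint nu' M (peak_poly M n) - pint nu M (peak_poly M n))).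
    exact: cvgB.
  by apply/funext => n; have := eqp1 (peak_poly M n); rewrite peak1; lra.
split=> // A mA.
have eqp p : pint nu M p = pint nu' M p by have := eqp1 p; rewrite dd'; lra.
apply: (@measure_unique _ R measR (@RGenInftyO.G R) (fun n => `]-oo, n%:R[%classic)) => //.
- exact: RGenInftyO.measurableE.
- move=> _ _ [x ->] [y ->]; exists (Num.min x y).
  by apply/seteqP; split => z /=; rewrite !in_itv/= lt_min => /andP.
- by move=> n; exists n%:R.
- apply/seteqP; split => // x _; exists (Num.truncn `|x|).+1 => //=.
  by rewrite in_itv/= (le_lt_trans (ler_norm _))// truncnS_gt.
- move=> _ [a ->]; have h := cvg_pint_stone (a := a) M0 nuM.
  suff E : nu `]-oo, a[%classic = nu' `]-oo, a[%classic by exact: E.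
  rewrite -(cvg_lim _ h)//; apply: cvg_lim => //.
  under eq_fun do rewrite eqp; exact: cvg_pint_stone.
- by move=> k; rewrite -ge0_fin_numE//; exact: fin_num_measure.
Qed.

End moment_uniqueness.

(** * Solving the Stieltjes moment problem with exponential growth *)

Section finite_pushforward.
Context d d' {T : measurableType d} {T' : measurableType d'} {R : realType}.
Variables (mu : {finite_measure set T -> \bar R}) (phi : {mfun T >-> T'}).

Definition finite_pushforward := pushforward mu phi.

Let fpush0 : finite_pushforward set0 = 0%E.
Proof. exact: measure0. Qed.

Let fpush_ge0 A : (0 <= finite_pushforward A)%E.
Proof. exact: measure_ge0. Qed.

Let fpush_sigma_additive : semi_sigma_additive finite_pushforward.
Proof. exact: measure_semi_sigma_additive. Qed.

HB.instance Definition _ := isMeasure.Build _ _ _ finite_pushforward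
  fpush0 fpush_ge0 fpush_sigma_additive.

Let fpush_fin : fin_num_fun finite_pushforward.
Proof.
move=> A mA; apply: fin_num_measure.
by rewrite -[_ @^-1` _]setTI; exact: measurable_funPT.
Qed.

HB.instance Definition _ := Measure_isFinite.Build _ _ _ finite_pushforward fpush_fin.

End finite_pushforward.

Section stieltjes.
Variable R : realType.
Local Notation measR := (measurableTypeR R).
Local Notation leb := (@lebesgue_measure R).
Implicit Types (nu : {finite_measure set measR -> \bar R}) (p q : {poly R}) (M : R).

(** The image of Lebesgue measure on [0, a[ under the map M f. *)
Lemma quantile_measure (f : R -> R) (a M : R) : unit_nd f -> 0 < M ->
  exists nu : {finite_measure set measR -> \bar R}, supported nu M /\
    forall n, pint nu M 'X^n = M ^+ n * \int[leb]_(u in `[0, a[) f u ^+ n.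
Proof.
move=> fu M0; have [fnd f01] := fu.
have mf : measurable_fun setT f by exact: nondecreasing_measurable.
have mphi : measurable_fun (setT : set measR) ((fun u => M * f u) : measR -> measR).
  by apply: measurable_funM => //; exact: measurable_cst.
pose phi : {mfun measR >-> measR} := HB.pack ((fun u => M * f u) : measR -> measR)
  (isMeasurableFun.Build _ _ _ _ _ mphi).
have mI : measurable (`[0, a[%classic : set measR) by [].
have Ioo : (leb (`[0%R, a[%classic : set measR) < +oo)%E.
  by rewrite lebesgue_measure_itv; case: ifP => _; rewrite ?ltry// -EFinB ltry.
pose mu1 : {finite_measure set measR -> \bar R} := mfrestr mI Ioo.
pose nu : {finite_measure set measR -> \bar R} := finite_pushforward mu1 phi.
have phi_itv : phi @^-1` `[0, M]%classic = setT.
  apply/seteqP; split => // u _ /=; rewrite in_itv/=; have /andP[f0 f1] := f01 u.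
  by rewrite mulr_ge0 ?(ltW M0)//= ler_piMr// ltW.
exists nu; split.
  change (mu1 (~` (phi @^-1` `[0, M]%classic)) = 0%E).
  by rewrite phi_itv setCT measure0.
move=> n; rewrite /pint /Rintegral.
have mn : measurable_fun (setT : set measR) (fun x : measR => (x ^+ n)%:E).
  by apply/measurable_EFinP; exact: measurable_funX.
rewrite -RintegralZl//; last exact: (unit_nd_integrable _ _ (unit_ndX n fu)).
rewrite /Rintegral; congr fine.
under eq_integral do rewrite hornerXn.
rewrite ge0_integral_pushforward//=; last 2 first.
- exact: measurable_funTS.
- by move=> x; rewrite inE/= in_itv/= => /andP[x0 _]; rewrite lee_fin exprn_ge0.
rewrite phi_itv.
rewrite (ge0_negligible_integral (N := (~` `[0, a[%classic : set measR)))//=.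
- rewrite setTD setCK; under eq_integral do rewrite exprMn.
  apply: eq_measure_integral => A mA AI.
  by rewrite /mu1 /= /mfrestr /mrestr setIidl.
- exact: measurableC.
- by apply/measurable_EFinP; exact: measurable_funX.
- by move=> u _; rewrite lee_fin exprn_ge0// mulr_ge0 ?(ltW M0)//; have /andP[] := f01 u.
- by rewrite /mu1 /= /mfrestr /mrestr setICl measure0.
Qed.

End stieltjes.

Section stieltjes_moment.
Variable R : realType.
Local Notation measR := (measurableTypeR R).
Implicit Types (nu : {finite_measure set measR -> \bar R}) (p q : {poly R}) (M : R).

Lemma momf_scale (s : nat -> R) (a : R) p :
  momf (fun n => s n * a ^+ n) p = momf s (p \Po (a *: 'X)).
Proof.
apply: (@eq_on_Xn _ (momf (fun n => s n * a ^+ n)) (momf s \o comp_poly (a *: 'X))) => n /=.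
by rewrite comp_Xn_poly exprZn linearZ/= !momfXn mulrC.
Qed.

(** After the rescaling x = M y the sequence is bounded, so that the measure lives
    on [0, 1] in the variable y. *)
Lemma stieltjes_moment (s : nat -> R) (C M : R) : 0 < M ->
  (forall n, `|s n| <= C * M ^+ n) ->
  (forall q, 0 <= momf s (q * q)) -> (forall q, 0 <= momf s ('X * (q * q))) ->
  exists nu, supported nu M /\ forall n, pint nu M 'X^n = s n.
Proof.
move=> M0 sC s0 s1; pose t n := s n * M^-1 ^+ n.
have t0 q : 0 <= momf t (q * q) by rewrite momf_scale comp_polyM.
have t1 q : 0 <= momf t ('X * (q * q)).
  rewrite momf_scale !comp_polyM comp_polyX -scalerAl linearZ/= mulr_ge0//.
  by rewrite invr_ge0 ltW.
have tC n : `|t n| <= C.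
  by rewrite normrM exprVn normrV ?unitfE ?expf_neq0 ?gt_eqF// [X in _ / X]gtr0_norm
    ?exprn_gt0// ler_pdivrMr ?exprn_gt0.
have [f [fu fE]] := hausdorff_moment (momf_bernstein_ge0 tC t0 t1).
have [nu [nuM nuE]] := quantile_measure (t 0%N) fu M0.
exists nu; split => // n; rewrite nuE fE /t exprVn mulrCA mulfV ?mulr1//.
by rewrite expf_neq0// gt_eqF.
Qed.

Lemma supported_split_atom mu M : 1 <= M -> supported mu M ->
  exists nu, [/\ supported nu M, nu [set 1] = 0%E &
    forall n, pint mu M 'X^n = fine (mu [set 1]) + pint nu M 'X^n].
Proof.
move=> M1 muM; have m1 : measurable ([set 1] : set measR) by exact: measurable_set1.
have mC : measurable (~` [set 1] : set measR) by exact: measurableC.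
have mI : measurable (`[0, M]%classic : set measR) by [].
pose nu : {finite_measure set measR -> \bar R} := mrestr mu mC.
have nu1 : nu [set 1] = 0%E by rewrite /nu /= /mrestr setICr measure0.
exists nu; split => // [|n].
  apply: (@subset_measure0 _ _ _ mu _ _ _ _ _ muM); last exact: subIsetl.
    by apply: measurableI => //; exact: measurableC.
  exact: measurableC.
have ID : `[0, M]%classic = [set 1] `|` (`[0, M]%classic `\` [set 1]) :> set measR.
  by rewrite setDUK// => x ->; rewrite /= in_itv/= ler01.
have int_n nu0 := @horner_integrable R nu0 M 'X^n.
rewrite /pint [in LHS]ID Rintegral_setU//; last 3 first.
- exact: measurableD.
- by rewrite -ID; exact: int_n.
- by apply/disj_setPS => x [->] [_] /=.
congr (_ + _).
  rewrite (@eq_Rintegral _ _ _ mu _ (fun=> 1)) ?Rintegral_cst ?mul1r//.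
  by move=> x; rewrite inE => /= ->; rewrite hornerXn expr1n.
rewrite [RHS]/Rintegral (negligible_integral m1 mI (int_n _) nu1); congr fine.
apply: eq_measure_integral => A mA AI.
by rewrite /nu /= /mrestr setIidl// => x /AI[].
Qed.

End stieltjes_moment.

(** * Powers of a weighted shift *)

Section weighted_shift_powers.
Variables (R : realType) (lam : nat -> R).
Hypotheses (lam_gt0 : forall n, 0 < lam n) (lam_bd : bounded_fun lam).
Implicit Types (h : ell2 R).

Local Notation g := (hat_seq lam).
Local Notation W := (wshift lam_bd).

Lemma hat_seq_gt0 n : 0 < g n.
Proof. by apply: prodr_gt0 => i _; rewrite exprn_gt0. Qed.

Lemma hat_seqS n : g n.+1 = g n * lam n ^+ 2.
Proof. by rewrite /hat_seq big_ord_recr. Qed.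

Lemma hat_seqD m n : g (m + n)%N = g m * \prod_(i < n) lam (m + i)%N ^+ 2.
Proof.
elim: n => [|n IH]; first by rewrite addn0 big_ord0 mulr1.
by rewrite addnS hat_seqS IH big_ord_recr/= mulrA.
Qed.

Lemma iter_wshift_lt n h k : (k < n)%N -> iter n W h k = 0 :> R[i].
Proof.
elim: n k => [//|n IH] [|k] //; rewrite ltnS => kn.
by rewrite [LHS](_ : _ = (lam k)%:C%C * iter n W h k)// IH// mulr0.
Qed.

Lemma iter_wshift_addn n h m :
  iter n W h (m + n)%N = (\prod_(i < n) lam (m + i)%N)%:C%C * h m.
Proof.
elim: n => [|n IH]; first by rewrite big_ord0 addn0 mul1r.
rewrite addnS [LHS](_ : _ = (lam (m + n)%N)%:C%C * iter n W h (m + n)%N)//.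
by rewrite IH big_ord_recr/= mulrA -rmorphM mulrC [X in X%:C%C]mulrC mulrC.
Qed.

Lemma sqsum_iter_wshift n h :
  sqsum (iter n W h) = (\sum_(m <oo) (normc (h m) ^+ 2 / g m * g (m + n)%N)%:E)%E.
Proof.
have ge0 (k : nat) : (0 <= (normc (iter n W h k) ^+ 2)%:E)%E by rewrite lee_fin sqr_ge0.
rewrite /sqsum (nneseries_split 0 n)// add0n big_nat_cond big1 ?add0e; last first.
  move=> k /andP[/andP[_ kn] _]; rewrite iter_wshift_lt//.
  by rewrite normc0 expr0n.
rewrite -(nneseries_addn n)//; apply: eq_eseriesr => m _; congr _%:E.
rewrite iter_wshift_addn normcM exprMn hat_seqD [RHS]mulrA divfK ?gt_eqF ?hat_seq_gt0//.
rewrite mulrC; congr (_ * _).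
rewrite /= expr0n addr0 sqrtr_sqr ger0_norm ?prodr_ge0 ?prodrXl//.
by move=> i _; exact: ltW.
Qed.

(** The sequence of the squared norms of W^n h is the combination of the sequences
    g (m + n), n >= 0, with nonnegative coefficients |h m|^2 / g m; for basis
    vectors h there is a single term.  Conditional positive definiteness passes to
    pointwise limits because it involves finitely many terms at a time. *)
Lemma cpd_operator_wshift :
  cpd_operator W <-> forall m, cpd_seq (fun n => g (m + n)%N).
Proof.
have normE h n : complex.Re (`|iter n W h| ^+ 2) = fine (sqsum (iter n W h)).
  by rewrite ell2_normrE -rmorphXn/= sqr_sqrtr// fine_ge0// sqsum_ge0.
split=> [Wcpd m|gcpd h].
  have sqE n : complex.Re (`|iter n W (ell2_basis R m)| ^+ 2) = (g m)^-1 * g (m + n)%N.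
    rewrite normE sqsum_iter_wshift (nneseries_split 0 m.+1); last first.
      by move=> k _; rewrite lee_fin mulr_ge0 ?divr_ge0 ?sqr_ge0// ltW// hat_seq_gt0.
    rewrite add0n eseries0 ?adde0; last first.
      by move=> k mk _; rewrite /= gtn_eqF// normc0 expr0n/= !mul0r.
    rewrite sumEFin big_mkord big_ord_recr/= big1 ?add0r; last first.
      by move=> i _; rewrite /= ltn_eqF// normc0 expr0n/= !mul0r.
    by rewrite eqxx normc1 expr1n mul1r.
  have /cpd_seqP gm := Wcpd (ell2_basis R m).
  apply/cpd_seqP => p /gm; rewrite (eq_momf sqE).
  rewrite [momf _ _](_ : _ = (g m)^-1 * momf (fun n => g (m + n)%N) (p * p)).
    by rewrite pmulr_rge0// invr_gt0 hat_seq_gt0.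
  by rewrite /momf mulr_sumr; apply: eq_bigr => i _; rewrite mulrCA.
apply/cpd_seqP => p p1.
pose c m := normc (h m) ^+ 2 / g m.
have c0 m : 0 <= c m by rewrite divr_ge0 ?sqr_ge0// ltW// hat_seq_gt0.
pose gN N n := \sum_(m < N) c m * g (m + n)%N.
have gN_cvg n : gN ^~ n @ \oo --> complex.Re (`|iter n W h| ^+ 2).
  have Fc : (fun N => (\sum_(0 <= m < N) (c m * g (m + n)%N)%:E)%E) @ \oo -->
      (fine (sqsum (iter n W h)))%:E.
    rewrite fineK ?sqsum_fin_num// sqsum_iter_wshift.
    apply: is_cvg_nneseries => k _ _.
    by rewrite lee_fin mulr_ge0// ltW// hat_seq_gt0.
  rewrite normE (_ : gN ^~ n = fine \o (fun N => (\sum_(0 <= m < N) (c m * g (m + n)%N)%:E)%E)).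
    exact: fine_cvg.
  by apply/funext => N /=; rewrite sumEFin/= big_mkord.
have momf_cvg : (fun N => momf (gN N) (p * p)) @ \oo -->
    momf (fun n => complex.Re (`|iter n W h| ^+ 2)) (p * p).
  apply: cvg_big => [|i _]; first exact: add_continuous.
  by apply: cvgM; [exact: cvg_cst|exact: gN_cvg].
apply: (@closed_cvg _ _ \oo _ (fun N => momf (gN N) (p * p)) (fun x => 0 <= x) (@closed_ge R 0) _ _ momf_cvg).
apply: nearW => N.
rewrite [momf _ _](_ : _ = \sum_(m < N) c m * momf (fun n => g (m + n)%N) (p * p)).
  apply: sumr_ge0 => m _; rewrite mulr_ge0//.
  by have /cpd_seqP := gcpd m; exact.
rewrite /momf; under eq_bigr do rewrite mulr_sumr.
rewrite exchange_big/=; apply: eq_bigr => m _; rewrite mulr_sumr.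
by apply: eq_bigr => i _; rewrite mulrCA.
Qed.

End weighted_shift_powers.

(** * Representing triplets *)

Section triplets.
Variables (R : realType) (lam : nat -> R).
Hypotheses (lam_gt0 : forall n, 0 < lam n) (lam_bd : bounded_fun lam).
Local Notation measR := (measurableTypeR R).
Local Notation g := (hat_seq lam).
Implicit Types (nu : {finite_measure set measR -> \bar R}) (p q : {poly R}) (M : R).

Lemma coef_Qpoly n j : (Qpoly R n)`_j = (n - j - 1)%:R.
Proof.
rewrite coef_poly; case: ltnP => // nj; rewrite (_ : n - j - 1 = 0)%N//; lia.
Qed.

Lemma Qpoly_eq0 n : (n <= 1)%N -> Qpoly R n = 0.
Proof.
move=> n1; apply/polyP => j; rewrite coef_Qpoly coef0 (_ : n - j - 1 = 0)%N//; lia.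
Qed.

(** This is what the polynomials Q_n are made for: they solve the recurrence
    Q_(n+2) - 2 Q_(n+1) + Q_n = x^n with zero initial values. *)
Lemma diff2_Qpoly n : Qpoly R n.+2 - 2 *: Qpoly R n.+1 + Qpoly R n = 'X^n.
Proof.
apply/polyP => j; rewrite coefD coefB coefZ !coef_Qpoly coefXn.
have [jn|nj|->] := ltngtP j n.
- have [k ->] : exists k, n = (j + k.+1)%N by exists (n - j).-1; lia.
  rewrite (_ : _.+2 - j - 1 = k.+2)%N; last lia.
  rewrite (_ : _.+1 - j - 1 = k.+1)%N; last lia.
  rewrite (_ : j + _ - j - 1 = k)%N; last lia.
  by rewrite mulr0n -!natr1; ring.
- have e k : (k <= j.+1)%N -> (k - j - 1 = 0)%N by lia.
  by rewrite !e ?mulr0n; [ring|lia..].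
rewrite (_ : n.+2 - n - 1 = 1)%N; last lia.
rewrite (_ : n.+1 - n - 1 = 0)%N; last lia.
rewrite (_ : n - n - 1 = 0)%N; last lia.
by rewrite mulr0n mulr1n; ring.
Qed.

Lemma second_difference_eq (u v : nat -> R) : u 0%N = v 0%N -> u 1%N = v 1%N ->
  diff2 u =1 diff2 v -> u =1 v.
Proof.
move=> uv0 uv1 uv n; suff [] : u n = v n /\ u n.+1 = v n.+1 by [].
elim: n => [//|n [IH0 IH1]]; split => //.
by have := uv n; rewrite /diff2 IH0 IH1; lra.
Qed.

Lemma diff2_representation nu M (b c : R) n :
  diff2 (fun n => 1 + b * n%:R + c * n%:R ^+ 2 + pint nu M (Qpoly R n)) n =
  2 * c + pint nu M 'X^n.
Proof.
rewrite -diff2_Qpoly linearD linearB linearZ/= /diff2 -!natr1; ring.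
Qed.

Lemma cpd_triplet_supported b c nu : cpd_triplet lam b c nu ->
  exists2 M, 0 <= M & supported nu M.
Proof. by case=> _ [nu0 nuK] _ _; exact: compact_msupp_supported. Qed.

Lemma cpd_tripletE b c nu M : supported nu M ->
  cpd_triplet lam b c nu <-> [/\ 0 <= c, nu [set 1] = 0%E &
    forall n, g n = 1 + b * n%:R + c * n%:R ^+ 2 + pint nu M (Qpoly R n)].
Proof.
move=> nuM; split=> [[c0 _ nu1 gE]|[c0 nu1 gE]].
  by split => // n; apply: EFin_inj; rewrite gE (pint_integral _ nuM).
split => //; last by move=> n; rewrite gE (pint_integral _ nuM).
by split; [exact: supported_lt0 nuM|exact: supported_compact_msupp nuM].
Qed.

Lemma diff2_cpd_triplet b c nu M : supported nu M -> cpd_triplet lam b c nu ->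
  forall n, diff2 g n = 2 * c + pint nu M 'X^n.
Proof.
move=> nuM /(cpd_tripletE _ _ nuM)[c0 nu1 gE] n; rewrite -(diff2_representation nu M b).
by rewrite /diff2 !gE.
Qed.

Lemma hat_seq0 : g 0%N = 1. Proof. by rewrite /hat_seq big_ord0. Qed.

(** On a square x^m q^2 the functional of the second differences of g takes the
    value 2 c q(1)^2 + int x^m q^2 dnu, where x >= 0 on the support of nu. *)
Lemma cpd_triplet_cpd b c nu m : cpd_triplet lam b c nu -> cpd_seq (fun n => g (m + n)%N).
Proof.
move=> tri; have [M M0 nuM] := cpd_triplet_supported tri; have [c0 _ _ _] := tri.
apply/cpd_seq_diff2P => q.
have -> : momf (diff2 (fun n => g (m + n)%N)) (q * q) =
    2 * c * ('X^m * (q * q)).[1] + pint nu M ('X^m * (q * q)).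
  rewrite (eq_momf (t := fun n => diff2 g (m + n)%N)); last first.
    by move=> n; rewrite /diff2 !addnS.
  rewrite -momf_mulXn pint_momf horner_coef mulr_sumr -big_split/=.
  apply: eq_bigr => i _; rewrite (diff2_cpd_triplet nuM tri) expr1n; ring.
rewrite addr_ge0//; first by rewrite !mulr_ge0// hornerM hornerXn expr1n mul1r hornerM -expr2 sqr_ge0.
apply: pint_ge0 => x /andP[x0 _].
by rewrite hornerM hornerXn hornerM mulr_ge0 ?exprn_ge0// -expr2 sqr_ge0.
Qed.

Lemma hat_seq_bounded : exists2 K, 1 <= K & forall n, g n <= K ^+ n.
Proof.
have [B [_ /(_ (`|B| + 1))]] := lam_bd.
have Blt : B < `|B| + 1 by rewrite (le_lt_trans (ler_norm B))// ltrDl.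
move=> /(_ Blt) lamB; exists ((`|B| + 1) ^+ 2).
  by rewrite exprn_ege1// lerDr.
move=> n; rewrite -[in leRHS](card_ord n) -prodr_const; apply: ler_prod => i _.
have lam0 := ltW (lam_gt0 i); rewrite exprn_ge0//=.
have lamK : lam i <= `|B| + 1 by have /= := lamB i I; rewrite ger0_norm.
by rewrite lerXn2r// nnegrE// (le_trans lam0).
Qed.

(** The hypotheses on g and on its shift make the second differences of g a
    Stieltjes moment sequence.  The mass at 1 of the representing measure becomes
    2 c, and b is dictated by the value at n = 1. *)
Lemma cpd_triplet_exists : cpd_seq g -> cpd_seq (fun n => g (1 + n)%N) ->
  exists b c nu, cpd_triplet lam b c nu.
Proof.
move=> /cpd_seq_diff2P g0 /cpd_seq_diff2P g1.
have [K K1 gK] := hat_seq_bounded; have K0 : 0 < K by lra.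
have bnd n : `|diff2 g n| <= (K ^+ 2 + 2 * K + 1) * K ^+ n.
  have := gK n; have := gK n.+1; have := gK n.+2; rewrite !exprS => h2 h1 h0.
  have p0 := hat_seq_gt0 lam_gt0 n; have p1 := hat_seq_gt0 lam_gt0 n.+1.
  have p2 := hat_seq_gt0 lam_gt0 n.+2.
  by rewrite /diff2 ler_norml; apply/andP; split; lra.
have [|mu [muK muE]] := stieltjes_moment K0 bnd g0.
  move=> q; rewrite -['X]expr1 momf_mulXn; have := g1 q; congr (_ <= momf _ _).
have [nu [nuK nu1 nuE]] := supported_split_atom K1 muK.
pose c := fine (mu [set 1]) / 2.
exists (g 1%N - 1 - c), c, nu; apply/(cpd_tripletE _ _ nuK); split => //.
  by rewrite divr_ge0 ?fine_ge0.
apply: second_difference_eq => [||n].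
- by rewrite hat_seq0 Qpoly_eq0// linear0; ring.
- by rewrite Qpoly_eq0// linear0; ring.
by rewrite diff2_representation -muE nuE /c; congr (_ + _); field.
Qed.

Lemma cpd_triplet_unique b c b' c' nu nu' :
  cpd_triplet lam b c nu -> cpd_triplet lam b' c' nu' ->
  [/\ b = b', c = c' & forall A, measurable A -> nu A = nu' A].
Proof.
move=> tri tri'; have [M M0 nuM] := cpd_triplet_supported tri.
have [M' M0' nuM'] := cpd_triplet_supported tri'.
have N0 : 0 <= Num.max M M' by rewrite le_max M0.
have nuN : supported nu (Num.max M M') by apply: supportedW nuM; rewrite le_max lexx.
have nuN' : supported nu' (Num.max M M').
  by apply: supportedW nuM'; rewrite le_max lexx orbT.
have /(cpd_tripletE _ _ nuN)[_ nu1 gE] := tri.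
have /(cpd_tripletE _ _ nuN')[_ nu1' gE'] := tri'.
have [|cc' nunu'] := @supported_moments_unique _ nu nu' _ (2 * c) (2 * c') N0 nuN nuN' nu1 nu1'.
  by move=> n; rewrite -(diff2_cpd_triplet nuN tri) (diff2_cpd_triplet nuN' tri').
split=> //; last lra.
have := gE 1%N; rewrite gE' Qpoly_eq0// !linear0; lra.
Qed.

(** If r exceeds the upper limit, then g n <= r^n eventually, so that the moments
    of nu, which are at most g (n + 2) + g n, are O(r^n).  A point of the support
    beyond r would make them grow faster. *)
Lemma cpd_triplet_msupp b c nu : cpd_triplet lam b c nu ->
  msupp nu `<=` [set x : R | 0 <= x /\
    (x%:E <= limn_esup (fun n => (g n `^ n%:R^-1)%:E))%E].
Proof.
move=> tri; have [M M0 nuM] := cpd_triplet_supported tri; have [c0 _ _ _] := tri.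
move=> x nux; have := supported_msupp nuM nux; rewrite /= in_itv/= => /andP[x0 xM].
split => //; rewrite leNgt; apply/negP => /ereal_inf_lt[_ [A [N _ NA] <-] supA].
(* S is the supremum of the n-th roots over a tail; it lies below x. *)
set S := ereal_sup _ in supA.
have S_ge n : (N <= n)%N -> ((g n `^ n%:R^-1)%:E <= S)%E.
  by move=> Nn; apply: ereal_sup_ubound; exists n => //; exact: NA.
have S0 : (0 <= S)%E by apply: le_trans (S_ge N (leqnn N)); rewrite lee_fin powR_ge0.
have [s sE] : exists s, S = s%:E.
  by exists (fine S); rewrite fineK// ge0_fin_numE// (lt_trans supA)// ltry.
move: supA S0; rewrite sE lte_fin lee_fin => sx s0.
pose r := (s + x) / 2; pose r' := (r + x) / 2.
have r0 : 0 < r by rewrite /r; lra.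
have rr' : r < r' by rewrite /r' /r; lra.
have r'x : r' < x by rewrite /r' /r; lra.
have gr n : (N < n)%N -> g n < r ^+ n.
  move=> Nn; apply: powR_inv_lt; [exact: hat_seq_gt0|exact: leq_ltn_trans Nn|].
  have := S_ge n (ltnW Nn); rewrite sE lee_fin => /le_lt_trans; apply.
  by rewrite /r; lra.
pose d := fine (nu `]r', +oo[%classic).
have d0 : 0 < d.
  rewrite fine_gt0//; apply/andP; split.
    by apply: nux; [exact: interval_open|rewrite /= in_itv/= r'x].
  by rewrite -ge0_fin_numE//; exact: fin_num_measure.
have rn n : (N < n)%N -> (r' / r) ^+ n * d <= r ^+ 2 + 1.
  move=> Nn; rewrite expr_div_n mulrAC ler_pdivrMr ?exprn_gt0//.
  have h1 := pint_tail n (ltW (lt_trans r0 rr')) nuM.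
  have := diff2_cpd_triplet nuM tri n; rewrite /diff2.
  have := gr n Nn; have := gr n.+2 (leqW (leqW Nn)); rewrite !exprS => h2 h3.
  have := hat_seq_gt0 lam_gt0 n.+1; rewrite -/d in h1; lra.
have r1 : 1 < r' / r by rewrite ltr_pdivlMr// mul1r.
have [k] := exprn_unbounded r1 ((r ^+ 2 + 1) / d).
rewrite ltr_pdivrMr// ltNge => /negP; apply.
apply: le_trans (rn (k + N.+1)%N _); last by rewrite addnS ltnS leq_addl.
by rewrite ler_wpM2r ?(ltW d0)// ler_weXn2l ?leq_addr// ltW.
Qed.

End triplets.

Theorem theorem3p1 (R : realType) (lam : nat -> R)
    (lam_gt0 : forall n, 0 < lam n) (lam_bd : bounded_fun lam) :
  [/\ cpd_operator (wshift lam_bd) <->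
        exists (b c : R) (nu : {finite_measure set (measurableTypeR R) -> \bar R}),
          cpd_triplet lam b c nu,
      forall (b c b' c' : R)
             (nu nu' : {finite_measure set (measurableTypeR R) -> \bar R}),
        cpd_triplet lam b c nu -> cpd_triplet lam b' c' nu' ->
        [/\ b = b', c = c' &
            forall A : set (measurableTypeR R), measurable A -> nu A = nu' A]
    & forall (b c : R) (nu : {finite_measure set (measurableTypeR R) -> \bar R}),
        cpd_triplet lam b c nu ->
        msupp nu `<=`
          [set x : R | 0 <= x /\
             (x%:E <= limn_esup (fun n => (hat_seq lam n `^ n%:R^-1)%:E))%E] ].
Proof.
split; first split=> [/(cpd_operator_wshift lam_gt0) gcpd|[b [c [nu tri]]]].
- exact: cpd_triplet_exists lam_gt0 lam_bd (gcpd 0%N) (gcpd 1%N).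
- by apply/(cpd_operator_wshift lam_gt0) => m; exact: cpd_triplet_cpd tri.
- by move=> b c b' c' nu nu'; exact: cpd_triplet_unique.
- by move=> b c nu; exact: cpd_triplet_msupp.
Qed.
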